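(* For every integer $n>1$, the set $\mathcal{R}_n=\big\{f\in A(\mathbb{D}) : \beta(f^{(n)})\notin \ell^1\big\}$ is a $G_\delta$ and dense subset of $A(\mathbb{D})$.
   Context: $\mathbb{D}$ is the open unit disc in $\mathbb{C}$. The disc algebra $A(\mathbb{D})$ is the set of functions $f:\overline{\mathbb{D}}\to\mathbb{C}$ that are continuous on $\overline{\mathbb{D}}$ and holomorphic on $\mathbb{D}$, with the supremum norm. For a holomorphic function $g$ on $\mathbb{D}$, $\beta(g)=(\beta_k(g))_{k=0}^\infty$ is the sequence of its Taylor coefficients at $0$, i.e. $g(z)=\sum_{k\ge0}\beta_k(g)z^k$; $f^{(n)}$ denotes the $n$-th complex derivative of $f$ on $\mathbb{D}$. $\ell^1$ is the set of absolutely summable complex sequences. *)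

(* Defs.v *)
From HB Require Import structures.
From mathcomp Require Import all_boot all_order all_algebra.
From mathcomp Require Import complex.
From mathcomp Require Import all_classical all_reals all_analysis.

Set Implicit Arguments.
Unset Strict Implicit.
Unset Printing Implicit Defensive.

Import Order.TTheory GRing.Theory Num.Theory.
Import numFieldNormedType.Exports.

Local Open Scope classical_set_scope.
Local Open Scope ring_scope.

(* The usual norm and topology on the complex field R[i], which the library
   provides only on the alias R[i]^o. *)
HB.instance Definition _ (R : realType) := NormedModule.copy R[i] R[i]^o.

Section DiscAlgebra.
Context {R : realType}.
Local Notation C := R[i].

Definition unit_disc : set C := [set z | `|z| < 1].

Definition closed_unit_disc : set C := [set z | `|z| <= 1].

(* Differentiation is with respect to the scalar field C, hence complex. *)
Definition holomorphic_on (U : set C) (f : C -> C) : Prop :=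
  forall z, U z -> derivable f z 1.

(* A function on the closed disc is represented by its extension by 0 to C, so
   that equality in the disc algebra is equality of functions on the closed
   disc.  Continuity is that of the restriction to the closed disc. *)
Definition in_disc_algebra (f : C -> C) : Prop :=
  [/\ {within closed_unit_disc, continuous f},
      holomorphic_on unit_disc f
    & forall z, ~ closed_unit_disc z -> f z = 0].

Definition disc_algebra_pred : {pred C -> C} :=
  fun f => `[< in_disc_algebra f >].

Lemma disc_algebraP (f : C -> C) :
  reflect (in_disc_algebra f) (f \in disc_algebra_pred).
Proof. exact: asboolP. Qed.

Lemma disc_algebra_submod_closed : submod_closed disc_algebra_pred.
Proof.
split.
  apply/disc_algebraP; split => //.
  by apply: continuous_subspaceT => z; exact: cst_continuous.
move=> a f g /disc_algebraP[cf hf f0] /disc_algebraP[cg hg g0].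
apply/disc_algebraP; split.
- move=> z; apply: cvgD; last exact: cg.
  by apply: cvgZr; exact: cf.
- move=> z Uz; apply: derivableD; last exact: hg.
  by apply: derivableZ; exact: hf.
- by move=> z nz; rewrite !fctE f0// g0// scaler0 addr0.
Qed.

HB.instance Definition _ := GRing.isSubmodClosed.Build C (C -> C)
  disc_algebra_pred disc_algebra_submod_closed.

End DiscAlgebra.

Record disc_algebra (R : realType) := DiscAlgebra {
  disc_algebra_fun :> R[i] -> R[i];
  disc_algebra_mem : disc_algebra_fun \in disc_algebra_pred
}.

HB.instance Definition _ (R : realType) :=
  [isSub for @disc_algebra_fun R].
HB.instance Definition _ (R : realType) :=
  [Choice of disc_algebra R by <:].
HB.instance Definition _ (R : realType) :=
  [SubChoice_isSubLmodule of disc_algebra R by <:].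

Section SupNorm.
Context {R : realType}.
Local Notation C := R[i].
Implicit Types f g : disc_algebra R.

Lemma normcE (z : C) : `|z| = (Normc.normc z)%:C%C.
Proof. by []. Qed.

Lemma continuous_Complex :
  continuous (fun p : R * R => (p.1 +i* p.2)%C : C).
Proof.
move=> p; apply/cvgrPdist_lt => -[e ei]; rewrite ltcE /= => /andP[/eqP-> e0].
near=> q.
rewrite normcE ltcR.
have -> : (p.1 +i* p.2)%C - (q.1 +i* q.2)%C =
    ((p.1 - q.1)%:C + (p.2 - q.2)%:C * 'i)%C :> C by simpc.
apply: le_lt_trans (le_normcD _ _) _.
rewrite Normc.normcM /= !(expr0n, expr1n, addr0, add0r)/= sqrtr1 mulr1.
rewrite !sqrtr_sqr (splitr e) ltrD//.
- near: q; have /cvgrPdist_lt : fst q @[q --> p] --> p.1 by exact: cvg_fst.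
  by apply; rewrite divr_gt0.
- near: q; have /cvgrPdist_lt : snd q @[q --> p] --> p.2 by exact: cvg_snd.
  by apply; rewrite divr_gt0.
Unshelve. all: by end_near. Qed.

Lemma continuous_normc : continuous ((fun z => Normc.normc z) : C -> R).
Proof.
move=> z; apply/(@cvgrPdist_lt _ R _ (nbhs z)) => e e0.
have e0C : 0 < e%:C%C :> C by rewrite ltcR.
apply: filterS (nbhsx_ballx z _ e0C) => w; rewrite -ball_normE /= => zw.
rewrite -ltcR; apply: le_lt_trans zw.
rewrite (_ : (`|Normc.normc z - Normc.normc w|)%:C%C = `| `|z| - `|w| | :> C).
  exact: ler_dist_dist.
by rewrite !normcE -rmorphB /= expr0n/= addr0 sqrtr_sqr.
Qed.

Lemma closed_unit_disc_compact : compact (@closed_unit_disc R).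
Proof.
pose S := (`[-1, 1]%classic `*` `[-1, 1]%classic) `&`
  (fun p : R * R => Normc.normc (p.1 +i* p.2)%C) @^-1` [set x | x <= 1].
have cS : compact S.
  apply: compact_closedI.
    by apply: compact_setX; exact: segment_compact.
  apply: closed_comp; last exact: closed_le.
  move=> p _; apply: continuous_comp; first exact: continuous_Complex.
  exact: continuous_normc.
have -> : closed_unit_disc = (fun p : R * R => (p.1 +i* p.2)%C : C) @` S.
  apply/seteqP; split => [[a b]|_ [[a b] [_ h] <-]].
    move=> zle; exists (a, b) => //; split; last first.
      by move: zle; rewrite /closed_unit_disc /= -lecR.
    have ab1 : a ^+ 2 + b ^+ 2 <= 1.
      move: zle; rewrite /closed_unit_disc /= normcE lecR /=.
      by rewrite -[X in _ <= X]sqrtr1 ler_sqrt.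
    rewrite /= !in_itv /= -!ler_norml; split.
      rewrite -(@expr_le1 _ 2)// real_normK ?num_real//.
      by rewrite (le_trans _ ab1)// lerDl sqr_ge0.
    rewrite -(@expr_le1 _ 2)// real_normK ?num_real//.
    by rewrite (le_trans _ ab1)// lerDr sqr_ge0.
  by rewrite /closed_unit_disc /= normcE lecR.
apply: continuous_compact => //.
exact/continuous_subspaceT/continuous_Complex.
Qed.

(* Normc.normc z is the modulus of z as an element of R, while `|z| : C. *)
Definition sup_norm f : R :=
  sup [set Normc.normc (f z) | z in closed_unit_disc].

Lemma sup_norm_has_sup f :
  has_sup [set Normc.normc (f z) | z in closed_unit_disc].
Proof.
apply: compact_has_sup.
  by exists (Normc.normc (f 0)), 0 => //; rewrite /closed_unit_disc/= normr0.
apply: continuous_compact closed_unit_disc_compact.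
have [cf _ _] := disc_algebraP _ (disc_algebra_mem f).
by move=> z; apply: continuous_comp; [exact: cf|exact: continuous_normc].
Qed.

Lemma le_sup_norm f z : closed_unit_disc z -> Normc.normc (f z) <= sup_norm f.
Proof.
move=> Dz; apply: ub_le_sup; last by exists z.
by case: (sup_norm_has_sup f).
Qed.

Lemma sup_norm_le f (c : R) :
  (forall z, closed_unit_disc z -> Normc.normc (f z) <= c) -> sup_norm f <= c.
Proof.
move=> fc; apply: ge_sup; first by case: (sup_norm_has_sup f).
by move=> _ [z Dz <-]; exact: fc.
Qed.

Lemma normc_ge0 (z : C) : 0 <= Normc.normc z.
Proof. by case: z => a b; exact: sqrtr_ge0. Qed.

Lemma sup_norm_ge0 f : 0 <= sup_norm f.
Proof.
apply: le_trans (normc_ge0 (f 0)) (le_sup_norm _ _).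
by rewrite /closed_unit_disc/= normr0.
Qed.

Lemma sup_normD f g :
  (sup_norm (f + g))%:C%C <= (sup_norm f)%:C%C + (sup_norm g)%:C%C :> C.
Proof.
rewrite -rmorphD lecR; apply: sup_norm_le => z Dz.
by apply: le_trans (le_normcD _ _) _; rewrite lerD// le_sup_norm.
Qed.

Lemma sup_normZ (a : C) f :
  (sup_norm (a *: f))%:C%C = `|a| * (sup_norm f)%:C%C :> C.
Proof.
rewrite normcE -rmorphM; congr (_%:C)%C; apply/eqP.
have le_scale (b : C) g : sup_norm (b *: g) <= Normc.normc b * sup_norm g.
  apply: sup_norm_le => z Dz; rewrite [_ z]/(b * g z) Normc.normcM.
  by rewrite ler_wpM2l ?normc_ge0// le_sup_norm.
rewrite eq_le le_scale /=; have [->|a0] := eqVneq a 0.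
  by rewrite Normc.normc0 mul0r sup_norm_ge0.
rewrite -{1}[f](scalerK a0) -ler_pdivlMl; last first.
  rewrite lt_def normc_ge0 andbT; apply: contra_neq a0.
  exact: Normc.eq0_normc.
by rewrite -Normc.normcV le_scale.
Qed.

Lemma sup_norm_eq0 f : (sup_norm f)%:C%C = 0 :> C -> f = 0.
Proof.
move=> [f0]; apply/val_inj/funext => z /=.
have [Dz|nDz] := pselect (closed_unit_disc z).
  apply: Normc.eq0_normc; apply/eqP.
  by rewrite eq_le normc_ge0 andbT -f0 le_sup_norm.
by have [_ _ ->] := disc_algebraP _ (disc_algebra_mem f).
Qed.

HB.instance Definition _ :=
  Lmodule_isNormed.Build C (disc_algebra R) sup_normD sup_normZ sup_norm_eq0.

Lemma disc_algebra_normE f : `|f| = (sup_norm f)%:C%C.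
Proof. by []. Qed.

End SupNorm.

Section TaylorCoefficients.
Context {R : realType}.
Local Notation C := R[i].

Definition taylor_coef (g : C -> C) (k : nat) : C :=
  derive1n k g 0 / k`!%:R.

Definition ell1 : set (nat -> C) := [set u : nat -> C | cvgn [normed series u]].

(* derive1n n f only depends on f near the point considered, so on the open disc
   it does not see the extension by 0. *)
Definition nonsummable_derivative (n : nat) : set (disc_algebra R) :=
  [set f | ~ ell1 (taylor_coef (derive1n n f))].

End TaylorCoefficients.

(* Main.v *)
Require Import Defs.
From mathcomp Require Import all_boot all_order all_algebra.
From mathcomp Require Import all_classical all_reals all_analysis borel_hierarchy.
From mathcomp Require Import complex ring lra.

(** The set is described by its coefficient functionals.  The k-th Taylor
    coefficient of the n-th derivative of f is (k + n)!/k! times the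
    coefficient a_(k+n) of f itself, and Cauchy's estimate makes
    f |-> a_(k+n) a bounded linear functional on the disc algebra.  A sequence
    fails to be in l^1 exactly when, for every j, some partial sum of its moduli
    exceeds j; for the coefficients in question each of these conditions is open
    in f, so the set is a countable intersection of open sets
    ([Gdelta_nonsummable]).

    For density, take h(z) = sum_k z^k / k^2, which is in the disc algebra
    because the series converges uniformly on the closed disc.  As n > 1, the
    coefficients of its n-th derivative have modulus at least 1/2, so h is in the
    set.  If f is not in the set, then by linearity f + c h is, for every c <> 0
    ([dense_nonsummable]).

    What this needs from complex analysis is [taylor_expansion]: a function that
    is merely complex differentiable on the disc and bounded by M is, near 0, the
    sum of a power series with |a_k| <= 32^k M.  Any geometric bound would serve;
    32 is what the crude estimates below give.  The proof works with finite sums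
    in the place of contour integrals.

    - Midpoint sums along the boundary of a square, with 2^k points on each side,
      vanish on affine functions and are additive under cutting the square into
      quarters.  Goursat's bisection argument then shows that they tend to 0 as k
      grows ([goursat]).  Finitely many points where the function is only locally
      bounded are allowed: they are paid for by an additive weight that gives a
      square of side s around such a point at least sqrt s, while the contour sum
      there is O(s).
    - Applied to (F w - F c) / (w - c), this bounds |F c| by twice the maximum of
      |F| around c ([mean_value_bound]).
    - By induction, the divided differences of f at distinct nodes close to 0 are
      bounded by 32^m M, where m + 1 is the number of nodes ([divdiff_bound]).
    - Bounded second-order divided differences of (f z - f 0) / z give this
      quotient a derivative at 0.  Hence f = f 0 + z F with F differentiable on
      the disc and bounded by 32 M ([divided_shift]).  Iterating this step gives
      the power series. *)

Set Implicit Arguments.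
Unset Strict Implicit.
Unset Printing Implicit Defensive.

Import Order.TTheory GRing.Theory Num.Theory.
Import numFieldNormedType.Exports.

Local Open Scope classical_set_scope.
Local Open Scope ring_scope.

Section NonsummableDerivatives.
Context {R : realType}.
Local Notation C := R[i].
Local Notation N := (@Normc.normc R).
Local Notation Re := (@complex.Re R).
Local Notation Im := (@complex.Im R).

(** * Moduli, limits and complex derivatives *)

Lemma normcD z w : N (z + w) <= N z + N w.
Proof. exact: le_normcD. Qed.

Lemma normc_opp z : N (- z) = N z.
Proof. exact: normcN. Qed.

Lemma normc_distC z w : N (z - w) = N (w - z).
Proof. by rewrite -normc_opp opprB. Qed.

Lemma normcB_le z w : N (z - w) <= N z + N w.
Proof. by rewrite -(normc_opp w); exact: normcD. Qed.

Lemma normcB_ge z w : N z - N w <= N (z - w).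
Proof. by have := normcD (z - w) w; rewrite subrK; lra. Qed.

Lemma normc_eq0 z : (N z == 0) = (z == 0).
Proof.
by apply/eqP/eqP => [/Normc.eq0_normc//|->]; rewrite Normc.normc0.
Qed.

Lemma normc_gt0 z : (0 < N z) = (z != 0).
Proof. by rewrite lt_def normc_ge0 andbT normc_eq0. Qed.

Lemma normcM (z w : C) : N (z * w) = N z * N w.
Proof. exact: Normc.normcM. Qed.

Lemma normcX z k : N (z ^+ k) = N z ^+ k.
Proof.
by elim: k => [|k IH]; rewrite ?expr0 ?Normc.normc1// !exprS normcM IH.
Qed.

Lemma normc_real (x : R) : N x%:C%C = `|x|.
Proof. by rewrite /= expr0n addr0 sqrtr_sqr. Qed.

Lemma normc_nat k : N k%:R = k%:R.
Proof. by rewrite -(rmorph_nat (@real_complex R)) normc_real ger0_norm. Qed.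

Lemma normci : N 'i%C = 1.
Proof. by rewrite /= expr0n expr1n add0r sqrtr1. Qed.

Lemma normc_Re z : `|Re z| <= N z.
Proof.
case: z => a b /=; rewrite -sqrtr_sqr ler_sqrt ?addr_ge0 ?sqr_ge0//.
by rewrite lerDl sqr_ge0.
Qed.

Lemma normc_Im z : `|Im z| <= N z.
Proof.
case: z => a b /=; rewrite -sqrtr_sqr ler_sqrt ?addr_ge0 ?sqr_ge0//.
by rewrite lerDr sqr_ge0.
Qed.

Lemma normc_ReIm z : N z <= `|Re z| + `|Im z|.
Proof.
case: z => a b; rewrite [complex.Re _]/= [complex.Im _]/=.
have -> : (a +i* b)%C = a%:C%C + 'i%C * b%:C%C by simpc.
by apply: le_trans (normcD _ _) _; rewrite normcM normci mul1r !normc_real.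
Qed.

Lemma ltc_normc (z : C) (e : R) : (`|z| < e%:C%C) = (N z < e).
Proof. by rewrite Defs.normcE ltcR. Qed.

Lemma gt0_complex (e : C) : 0 < e -> exists2 r : R, 0 < r & e = r%:C%C.
Proof. by case: e => r i; rewrite ltcE /= => /andP[/eqP -> r0]; exists r. Qed.

Lemma cvg_complexP (u : nat -> C) (l : C) :
  (u n @[n --> \oo] --> l) <->
  (forall e : R, 0 < e -> exists K, forall n, (K <= n)%N -> N (u n - l) < e).
Proof.
split.
  move=> /cvgrPdist_lt ul e e0; have /ul : 0 < e%:C%C :> C by rewrite ltcR.
  case=> K _ H; exists K => n Kn; rewrite normc_distC -ltc_normc; exact: H.
move=> H; apply/cvgrPdist_lt => _ /gt0_complex[e e0 ->].
have [K HK] := H _ e0; exists K => // n Kn.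
by rewrite ltc_normc normc_distC HK.
Qed.

(** Complex differentiability in terms of the real-valued modulus, multiplied
    out: the point [w = z] needs no exclusion, and all estimates below stay in
    the ordered field R. *)
Definition cderiv_at (f : C -> C) z d := forall e : R, 0 < e ->
  exists2 r : R, 0 < r &
    forall w, N (w - z) < r -> N (f w - f z - d * (w - z)) <= e * N (w - z).

Lemma cderiv_atP f z d : cderiv_at f z d <-> is_derive (z : C) (1 : C) (f : C -> C) d.
Proof.
have key : cderiv_at f z d <->
   (h^-1 *: ((f \o shift z) (h *: (1:C)) - f z) @[h --> (0:C)^'] --> d).
  split=> H.
    apply/cvgrPdist_lt => _ /gt0_complex[e e0 ->].
    have [|r r0 Hr] := H (e / 2); first by lra.
    exists r%:C%C; first by rewrite /= ltcR.
    move=> h /=; rewrite sub0r normrN ltc_normc => hr h0.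
    rewrite ltc_normc; have hN : 0 < N h by rewrite normc_gt0.
    have -> : d - h^-1 *: (f (h *: (1:C) + z) - f z) =
        - (h^-1 * (f (h + z) - f z - d * (h + z - z))).
      by rewrite !/(_ *: _)/= mulr1; field.
    rewrite normc_opp normcM Normc.normcV mulrC ltr_pdivrMr//.
    apply: (@le_lt_trans _ _ (e / 2 * N (h + z - z))).
      by apply: Hr; rewrite addrK.
    by rewrite addrK ltr_pM2r//; lra.
  move=> e e0; move/cvgrPdist_lt : H => /(_ e%:C%C).
  rewrite ltcR => /(_ e0) [_ /gt0_complex[r r0 ->] Hr].
  exists r => // w wr; have [->|wz] := eqVneq w z.
    by rewrite !subrr mulr0 subr0 Normc.normc0 mulr0.
  have wz0 : w - z != 0 by rewrite subr_eq0.
  have := Hr (w - z); rewrite /= sub0r normrN ltc_normc => /(_ wr wz0).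
  rewrite ltc_normc => /ltW.
  have -> : d - (w - z)^-1 *: (f ((w - z) *: (1:C) + z) - f z) =
      - ((w - z)^-1 * (f w - f z - d * (w - z))).
    by rewrite !/(_ *: _)/= mulr1 subrK; field.
  by rewrite normc_opp normcM Normc.normcV mulrC ler_pdivrMr// normc_gt0.
split=> [/key H|[H1 H2]].
  split; first by apply/cvg_ex; exists d.
  exact: cvg_lim H.
by apply/key; rewrite -H2.
Qed.

Lemma cderiv_at_derive1 f z d : cderiv_at f z d -> derive1 (f : C -> C) z = d.
Proof. by move=> /cderiv_atP H; rewrite derive1E; exact: derive_val. Qed.

Lemma derivable_cderiv_at (f : C -> C) (z : C) : derivable f z (1 : C) -> exists d, cderiv_at f z d.
Proof. by move=> H; exists ('D_1 f z); apply/cderiv_atP; split. Qed.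

(** * Midpoint contour sums over squares *)

(** The midpoint Riemann sum with 2^k nodes for the integral of g along the
    segment from a to a + v.  The recursion on halves makes additivity hold by
    definition, and the midpoint rule is exact on affine functions at every
    level k. *)
Fixpoint midsum k (g : C -> C) (a v : C) : C :=
  if k is k'.+1 then midsum k' g a (v / 2) + midsum k' g (a + v / 2) (v / 2)
  else v * g (a + v / 2).

(** Counterclockwise around the square with corners z, z + w, z + w + iw and
    z + iw; the top and left sides are traversed backwards. *)
Definition contour k (g : C -> C) (z w : C) : C :=
  midsum k g z w + midsum k g (z + w) ('i%C * w)
  - midsum k g (z + 'i%C * w) w - midsum k g z ('i%C * w).

(** The four interior sides cancel in pairs.  Refining the mesh once and halving
    the square once go together, so no mesh ever has to be matched with a
    subdivision. *)
Lemma contourS k g z w : contour k.+1 g z w =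
  contour k g z (w / 2) + contour k g (z + w / 2) (w / 2) +
  contour k g (z + 'i%C * (w / 2)) (w / 2) +
  contour k g (z + w / 2 + 'i%C * (w / 2)) (w / 2).
Proof.
rewrite /contour /=.
have two : w / 2 + w / 2 = w by field.
have e1 : z + w / 2 + w / 2 = z + w by rewrite -addrA two.
have e2 : z + 'i%C * (w / 2) + 'i%C * (w / 2) = z + 'i%C * w.
  by rewrite -addrA -mulrDr two.
have e3 : z + w / 2 + 'i%C * (w / 2) + 'i%C * (w / 2) = z + 'i%C * w + w / 2.
  by rewrite -addrA -mulrDr two addrAC.
have e4 : z + 'i%C * (w / 2) + w / 2 = z + w / 2 + 'i%C * (w / 2).
  by rewrite addrAC.
have e5 : z + w / 2 + 'i%C * (w / 2) + w / 2 = z + w + 'i%C * (w / 2).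
  by rewrite addrAC e1.
by rewrite !mulrA -!mulrA e1 e2 e3 e4 e5; ring.
Qed.

Lemma midsum_affine k al be a v :
  midsum k (fun z => al * z + be) a v = v * (al * (a + v / 2) + be).
Proof. by elim: k a v => [//|k IH] a v /=; rewrite !IH; field. Qed.

Lemma contour_affine k al be z w :
  contour k (fun z => al * z + be) z w = 0.
Proof. by rewrite /contour !midsum_affine; field. Qed.

Lemma midsumB k f g a v :
  midsum k (fun z => f z - g z) a v = midsum k f a v - midsum k g a v.
Proof. by elim: k a v => [|k IH] a v /=; [rewrite mulrBr|rewrite !IH; ring]. Qed.

Lemma contourB k f g z w :
  contour k (fun z => f z - g z) z w = contour k f z w - contour k g z w.
Proof. by rewrite /contour !midsumB; ring. Qed.

Lemma midsumZ k c f a v :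
  midsum k (fun z => c * f z) a v = c * midsum k f a v.
Proof. by elim: k a v => [|k IH] a v /=; [rewrite mulrCA|rewrite !IH; ring]. Qed.

Lemma contourZ k c f z w :
  contour k (fun z => c * f z) z w = c * contour k f z w.
Proof. by rewrite /contour !midsumZ; ring. Qed.

Lemma real_complex_half (t : R) : (t / 2)%:C%C = t%:C%C / 2 :> C.
Proof. by rewrite rmorphM fmorphV rmorph_nat. Qed.

Lemma midsum_le k g a v M :
  (forall t : R, 0 <= t <= 1 -> N (g (a + t%:C%C * v)) <= M) ->
  N (midsum k g a v) <= N v * M.
Proof.
elim: k a v => [|k IH] a v H /=.
  rewrite normcM ler_wpM2l ?normc_ge0//.
  have -> : v / 2 = (1 / 2)%:C%C * v by rewrite real_complex_half rmorph1; field.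
  by apply: H; lra.
have -> : N v * M = N (v / 2) * M + N (v / 2) * M.
  have -> : N v = N (v / 2) + N (v / 2).
    by rewrite normcM Normc.normcV normc_nat; lra.
  by rewrite mulrDl.
apply: le_trans (normcD _ _) _; apply: lerD; apply: IH => t t01.
  have -> : t%:C%C * (v / 2) = (t / 2)%:C%C * v by rewrite real_complex_half; field.
  by apply: H; lra.
have -> : a + v / 2 + t%:C%C * (v / 2) = a + ((1 + t) / 2)%:C%C * v.
  by rewrite real_complex_half rmorphD rmorph1; field.
by apply: H; lra.
Qed.

(** The sum is an average of the values of v g; its imaginary part inherits
    every lower bound. *)
Lemma midsum_Im_ge k g a v m :
  (forall t : R, 0 <= t <= 1 -> m <= Im (v * g (a + t%:C%C * v))) ->
  m <= Im (midsum k g a v).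
Proof.
have half (u : C) : Im (u / 2) = Im u / 2.
  have -> : u / 2 = (2^-1)%:C%C * u by rewrite fmorphV rmorph_nat mulrC.
  by case: u => x y; simpc => /=; rewrite mulrC.
elim: k a v m => [|k IH] a v m H /=.
  have -> : v / 2 = (1 / 2)%:C%C * v by rewrite real_complex_half rmorph1; field.
  by apply: H; lra.
have -> : m = m / 2 + m / 2 by lra.
rewrite raddfD /=; apply: lerD; apply: IH => t t01.
  have -> : t%:C%C * (v / 2) = (t / 2)%:C%C * v by rewrite real_complex_half; field.
  rewrite mulrAC half ler_pM2r ?invr_gt0//; apply: H; lra.
have -> : a + v / 2 + t%:C%C * (v / 2) = a + ((1 + t) / 2)%:C%C * v.
  by rewrite real_complex_half rmorphD rmorph1; field.
rewrite mulrAC half ler_pM2r ?invr_gt0//; apply: H; lra.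
Qed.

Definition in_square (z : C) (s : R) (w : C) :=
  (Re z <= Re w <= Re z + s) && (Im z <= Im w <= Im z + s).

Definition on_edge (z : C) (s : R) (w : C) := in_square z s w &&
  [|| Re w == Re z, Re w == Re z + s, Im w == Im z | Im w == Im z + s].

Lemma on_edge_points z s t : 0 < s -> 0 <= t <= 1 ->
  [/\ on_edge z s (z + t%:C%C * s%:C%C),
      on_edge z s (z + s%:C%C + t%:C%C * ('i%C * s%:C%C)),
      on_edge z s (z + 'i%C * s%:C%C + t%:C%C * s%:C%C) &
      on_edge z s (z + t%:C%C * ('i%C * s%:C%C))].
Proof.
move=> s0 t01; have : 0 <= t * s <= s by nra.
case: z => x y; rewrite /on_edge /in_square; simpc => /= ts.
by split; rewrite ?eqxx ?orbT ?andbT; lra.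
Qed.

Lemma contour_le k g z s M : 0 < s ->
  (forall w, on_edge z s w -> N (g w) <= M) ->
  N (contour k g z s%:C%C) <= 4 * s * M.
Proof.
move=> s0 H.
have Ns : N s%:C%C = s by rewrite normc_real gtr0_norm.
have Nis : N ('i%C * s%:C%C) = s by rewrite normcM normci mul1r.
have h1 : N (midsum k g z s%:C%C) <= s * M.
  rewrite -{2}Ns; apply: midsum_le => t t01; apply: H.
  by case: (on_edge_points z s0 t01).
have h2 : N (midsum k g (z + s%:C%C) ('i%C * s%:C%C)) <= s * M.
  rewrite -[X in _ <= X * _]Nis; apply: midsum_le => t t01; apply: H.
  by case: (on_edge_points z s0 t01).
have h3 : N (midsum k g (z + 'i%C * s%:C%C) s%:C%C) <= s * M.
  rewrite -[X in _ <= X * _]Ns; apply: midsum_le => t t01; apply: H.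
  by case: (on_edge_points z s0 t01).
have h4 : N (midsum k g z ('i%C * s%:C%C)) <= s * M.
  rewrite -[X in _ <= X * _]Nis; apply: midsum_le => t t01; apply: H.
  by case: (on_edge_points z s0 t01).
have tri (a b c d : C) : N (a + b - c - d) <= N a + N b + N c + N d.
  have := normcB_le (a + b - c) d; have := normcB_le (a + b) c.
  have := normcD a b; lra.
have := tri (midsum k g z s%:C%C) (midsum k g (z + s%:C%C) ('i%C * s%:C%C))
  (midsum k g (z + 'i%C * s%:C%C) s%:C%C) (midsum k g z ('i%C * s%:C%C)).
rewrite /contour; lra.
Qed.

Lemma in_square_dist z s v w : in_square z s v -> in_square z s w ->
  N (v - w) <= 2 * s.
Proof.
rewrite /in_square => hv hw; have := normc_ReIm (v - w); rewrite !raddfB /=.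
have : `|Re v - Re w| <= s by rewrite ler_norml; lra.
have : `|Im v - Im w| <= s by rewrite ler_norml; lra.
lra.
Qed.

Lemma half_pow_lt (s d : R) : 0 < d -> exists n, s / 2 ^+ n < d.
Proof.
move=> d0; have [n hn] : exists n, s / d < n%:R.
  exists (Num.truncn `|s / d|).+1.
  by apply: le_lt_trans (ler_norm _) _; rewrite truncnS_gt.
exists n; rewrite ltr_pdivrMr ?exprn_gt0// mulrC -ltr_pdivrMr//.
apply: lt_le_trans hn _; rewrite -natrX ler_nat.
exact: (ltnW (ltn_expl n (isT : (1 < 2)%N))).
Qed.

Lemma nested_intervals (x : nat -> R) (s : R) : 0 < s ->
  (forall n, x n <= x n.+1 /\ x n.+1 + s / 2 ^+ n.+1 <= x n + s / 2 ^+ n) ->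
  exists t, forall n, x n <= t <= x n + s / 2 ^+ n.
Proof.
move=> s0 H.
have sp n : 0 < s / 2 ^+ n by rewrite divr_gt0 ?exprn_gt0.
have ndec m n : x m <= x (m + n)%N.
  elim: n => [|n IH]; first by rewrite addn0.
  by rewrite addnS; apply: le_trans IH _; case: (H (m + n)%N).
have ninc m n : x (m + n)%N + s / 2 ^+ (m + n)%N <= x m + s / 2 ^+ m.
  elim: n => [|n IH]; first by rewrite addn0.
  by rewrite addnS; apply: le_trans IH; case: (H (m + n)%N).
have ub m n : x n <= x m + s / 2 ^+ m.
  have [/subnKC <-|/ltnW/subnKC <-] := leqP m n.
    by apply: le_trans (ninc m (n - m)%N); rewrite lerDl ltW.
  apply: le_trans (ndec n (m - n)%N) _; rewrite lerDl ltW//.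
have hs : has_sup (range x).
  split; first by exists (x 0%N), 0%N.
  by exists (x 0%N + s / 2 ^+ 0) => _ [n _ <-].
exists (sup (range x)) => n; apply/andP; split.
  by apply: ub_le_sup; [case: hs | exists n].
by apply: ge_sup; [case: hs|move=> _ [m _ <-]].
Qed.

(** Bisection: if P failed on a square it would fail on one of the quarters, and
    the nested failing squares would shrink to a point around which P holds at
    all small scales. *)
Lemma square_induction (P : C -> R -> Prop) z s :
  (forall z s, 0 < s ->
     P z (s / 2) -> P (z + (s / 2)%:C%C) (s / 2) ->
     P (z + 'i%C * (s / 2)%:C%C) (s / 2) ->
     P (z + (s / 2)%:C%C + 'i%C * (s / 2)%:C%C) (s / 2) -> P z s) ->
  0 < s ->
  (forall w, in_square z s w -> exists2 r, 0 < r & forall z' s',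
     0 < s' < r -> in_square z' s' w -> P z' s') ->
  P z s.
Proof.
move=> join s0 loc; apply: contrapT => nP.
pose child (z z' : C) (s : R) :=
  [/\ Re z <= Re z', Im z <= Im z', Re z' + s / 2 <= Re z + s &
      Im z' + s / 2 <= Im z + s].
have /choice[nx Hnx] : forall q : C * R, exists z', 0 < q.2 -> ~ P q.1 q.2 ->
    child q.1 z' q.2 /\ ~ P z' (q.2 / 2).
  move=> [[x y] t] /=; apply: contrapT => /forallNP H.
  have t0 : 0 < t.
    by apply: contrapT => t0; apply: (H 0) => /t0.
  have nPt : ~ P (x +i* y)%C t.
    by move=> nPt; apply: (H 0) => _ /(_ nPt).
  apply: nPt; apply: join => //; apply: contrapT => nPt; apply: (H _);
    move=> _ _; (split; last exact: nPt); rewrite /child; simpc => /=;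
    by split; lra.
pose u := fix u n : C := if n is m.+1 then nx (u m, s / 2 ^+ m) else z.
have sp n : 0 < s / 2 ^+ n by rewrite divr_gt0 ?exprn_gt0.
have sS n : s / 2 ^+ n.+1 = s / 2 ^+ n / 2 by rewrite exprS; field; rewrite expf_neq0.
have nPu n : ~ P (u n) (s / 2 ^+ n).
  elim: n => [|n IH]; first by rewrite expr0 divr1.
  by rewrite sS; case: (Hnx (u n, s / 2 ^+ n) (sp n) IH).
have cu n : child (u n) (u n.+1) (s / 2 ^+ n).
  by case: (Hnx (u n, s / 2 ^+ n) (sp n) (nPu n)).
have [a Ha] : exists a, forall n, Re (u n) <= a <= Re (u n) + s / 2 ^+ n.
  by apply: nested_intervals => // n; rewrite sS; case: (cu n).
have [b Hb] : exists b, forall n, Im (u n) <= b <= Im (u n) + s / 2 ^+ n.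
  by apply: nested_intervals => // n; rewrite sS; case: (cu n).
have inQ n : in_square (u n) (s / 2 ^+ n) (a +i* b)%C.
  by rewrite /in_square /= Ha Hb.
have := inQ 0%N; rewrite expr0 divr1 => /loc[r r0 Hr].
have [n sn] := half_pow_lt s r0.
by apply: (nPu n); apply: Hr; rewrite ?sp.
Qed.

(** * Goursat's theorem with exceptional points *)

Lemma sqrtr_subadd (x y : R) : 0 <= x -> 0 <= y ->
  Num.sqrt (x + y) <= Num.sqrt x + Num.sqrt y.
Proof.
move=> x0 y0; have sx := sqrtr_ge0 x; have sy := sqrtr_ge0 y.
rewrite -[leRHS]ger0_norm ?addr_ge0// -sqrtr_sqr ler_wsqrtr//.
by rewrite sqrrD !sqr_sqrtr//; have := mulr_ge0 sx sy; lra.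
Qed.

(** Products of increments of this function along the two axes are additive under
    subdivision; across 0 an increment over length s is at least the fourth root
    of s, which makes the product of two at least sqrt s. *)
Definition signed_root4 (t : R) : R := Num.sg t * Num.sqrt (Num.sqrt `|t|).

Lemma signed_root4_ge0 t : 0 <= t -> signed_root4 t = Num.sqrt (Num.sqrt t).
Proof.
rewrite le_eqVlt /signed_root4 => /orP[/eqP <-|t0].
  by rewrite normr0 !sqrtr0 mulr0.
by rewrite gtr0_sg// mul1r gtr0_norm.
Qed.

Lemma signed_root4N t : signed_root4 (- t) = - signed_root4 t.
Proof. by rewrite /signed_root4 sgrN normrN mulNr. Qed.

Lemma signed_root4_gap a b : a <= 0 -> 0 <= b ->
  Num.sqrt (Num.sqrt (b - a)) <= signed_root4 b - signed_root4 a.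
Proof.
move=> a0 b0; rewrite -signed_root4N !signed_root4_ge0 ?oppr_ge0//.
apply: le_trans (sqrtr_subadd (sqrtr_ge0 _) (sqrtr_ge0 _)).
by apply/ler_wsqrtr/sqrtr_subadd; rewrite ?oppr_ge0.
Qed.

Lemma signed_root4_homo t t' : t <= t' -> signed_root4 t <= signed_root4 t'.
Proof.
have pos x y : 0 <= x -> x <= y -> signed_root4 x <= signed_root4 y.
  move=> x0 xy; rewrite !signed_root4_ge0//; last by lra.
  by do 2!apply: ler_wsqrtr.
move=> tt'; have [t0|t0] := leP 0 t; first exact: pos.
have [t'0|t'0] := leP 0 t'.
  have := @pos 0 t'; have := @pos 0 (- t).
  have -> : signed_root4 0 = 0 by rewrite /signed_root4 sgr0 mul0r.
  rewrite signed_root4N; lra.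
have := @pos (- t') (- t); rewrite !signed_root4N; lra.
Qed.

(** Mass of a square as seen from p.  It replaces a Dirac mass at p, which would
    not be additive when p lies on a common side of several quarters. *)
Definition point_weight (p z : C) (s : R) : R :=
  (signed_root4 (Re z + s - Re p) - signed_root4 (Re z - Re p)) *
  (signed_root4 (Im z + s - Im p) - signed_root4 (Im z - Im p)).

Lemma point_weight_ge0 p z s : 0 <= s -> 0 <= point_weight p z s.
Proof.
by move=> s0; apply: mulr_ge0; rewrite subr_ge0 signed_root4_homo//; lra.
Qed.

Lemma point_weight_ge p z s : in_square z s p ->
  Num.sqrt s <= point_weight p z s.
Proof.
rewrite /in_square => hp.
have s0 : 0 <= s by lra.
rewrite -[Num.sqrt s]sqr_sqrtr ?sqrtr_ge0// expr2; apply: ler_pM.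
- exact: sqrtr_ge0.
- exact: sqrtr_ge0.
- by have := @signed_root4_gap (Re z - Re p) (Re z + s - Re p);
    rewrite (_ : Re z + s - Re p - (Re z - Re p) = s); [apply; lra|ring].
- by have := @signed_root4_gap (Im z - Im p) (Im z + s - Im p);
    rewrite (_ : Im z + s - Im p - (Im z - Im p) = s); [apply; lra|ring].
Qed.

Definition weight (E : seq C) (z : C) (s : R) : R :=
  s ^+ 2 + \sum_(p <- E) point_weight p z s.

Lemma point_weight_quarters p z s :
  point_weight p z s =
   point_weight p z (s / 2) + point_weight p (z + (s / 2)%:C%C) (s / 2) +
   point_weight p (z + 'i%C * (s / 2)%:C%C) (s / 2) +
   point_weight p (z + (s / 2)%:C%C + 'i%C * (s / 2)%:C%C) (s / 2).
Proof.
case: z => x y; rewrite /point_weight; simpc => /=.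
have -> : x + s / 2 + s / 2 = x + s by field.
have -> : y + s / 2 + s / 2 = y + s by field.
by ring.
Qed.

Lemma weight_quarters E z s :
  weight E z s = weight E z (s / 2) + weight E (z + (s / 2)%:C%C) (s / 2) +
   weight E (z + 'i%C * (s / 2)%:C%C) (s / 2) +
   weight E (z + (s / 2)%:C%C + 'i%C * (s / 2)%:C%C) (s / 2).
Proof.
rewrite /weight (eq_bigr _ (fun p _ => point_weight_quarters p z s)).
by rewrite !big_split /=; field.
Qed.

Lemma weight_ge_sqr E z s : 0 <= s -> s ^+ 2 <= weight E z s.
Proof.
by move=> s0; rewrite lerDl sumr_ge0// => p _; exact: point_weight_ge0.
Qed.

Lemma weight_ge_sqrt E p z s : p \in E -> in_square z s p ->
  Num.sqrt s <= weight E z s.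
Proof.
move=> pE zp; have s0 : 0 <= s by move: zp; rewrite /in_square; lra.
rewrite /weight (big_rem p)//= addrCA.
apply: le_trans (point_weight_ge zp) _; rewrite lerDl.
by rewrite addr_ge0 ?sqr_ge0// sumr_ge0// => q _; exact: point_weight_ge0.
Qed.

Definition loc_bounded (f : C -> C) (p : C) :=
  exists M r : R, 0 < r /\ forall w, N (w - p) < r -> N (f w) <= M.

(** An affine function does not contribute, and the remainder is o(s) on a square
    of side s, whose perimeter is 4 s. *)
Lemma contour_small_diff f p d e : 0 < e -> cderiv_at f p d ->
  exists2 r, 0 < r & forall z s k, 0 < s < r -> in_square z s p ->
    N (contour k f z s%:C%C) <= e * s ^+ 2.
Proof.
move=> e0 fpd; have [|r r0 Hr] := fpd (e / 8); first by lra.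
(* Two points of a square of side s are at distance at most 2 s. *)
exists (r / 2) => [|z s k /andP[s0 sr] zp]; first by lra.
pose A w := d * w + (f p - d * p).
have -> : contour k f z s%:C%C = contour k (fun w => f w - A w) z s%:C%C.
  by rewrite contourB contour_affine subr0.
have -> : e * s ^+ 2 = 4 * s * (e / 8 * (2 * s)) by field.
apply: contour_le => // w /andP[zw _].
have wp := in_square_dist zw zp.
have -> : f w - A w = f w - f p - d * (w - p) by rewrite /A; ring.
apply: le_trans (Hr _ _) _; first by lra.
by rewrite ler_pM2l//; lra.
Qed.

(** The contour sum is O(s), which is negligible with respect to sqrt s. *)
Lemma contour_small_bounded f p e : 0 < e -> loc_bounded f p ->
  exists2 r, 0 < r & forall z s k, 0 < s < r -> in_square z s p ->
    N (contour k f z s%:C%C) <= e * Num.sqrt s.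
Proof.
move=> e0 [M [r [r0 HM]]].
have M0 : 0 <= M.
  apply: le_trans (normc_ge0 (f p)) (HM p _).
  by rewrite subrr Normc.normc0.
have q0 : 0 < e / (4 * M + 1) by rewrite divr_gt0//; lra.
(* The second bound gives 4 s M <= e (sqrt s) through sqrt s <= e / (4 M + 1). *)
exists (Num.min (r / 2) ((e / (4 * M + 1)) ^+ 2)).
  by rewrite lt_min exprn_gt0// divr_gt0.
move=> z s k; rewrite lt_min => /and3P[s0 sr sq] zp.
have h : Num.sqrt s <= e / (4 * M + 1).
  by rewrite -[leRHS](ger0_norm (ltW q0)) -sqrtr_sqr ler_wsqrtr// (ltW sq).
apply: (@le_trans _ _ (4 * s * M)).
  apply: contour_le => // w /andP[zw _]; apply: HM.
  have := in_square_dist zw zp; lra.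
have s1 := sqrtr_ge0 s.
have h2 : Num.sqrt s * (4 * M + 1) <= e.
  by rewrite -ler_pdivlMr//; lra.
rewrite -{1}[s](sqr_sqrtr (ltW s0)) expr2.
by nra.
Qed.

(** Bisection is applied to the bound by a multiple of the weight: the weight is
    additive, dominates s^2, which serves at the points of differentiability, and
    dominates sqrt s at the points of E. *)
Lemma goursat f (E : seq C) z0 s0 : 0 < s0 ->
  (forall w, in_square z0 s0 w -> w \notin E -> exists d, cderiv_at f w d) ->
  (forall p, p \in E -> loc_bounded f p) ->
  forall e : R, 0 < e -> exists K, forall k, (K <= k)%N ->
    N (contour k f z0 s0%:C%C) <= e.
Proof.
move=> s00 Hd Hb e e0.
have w0 : 0 < weight E z0 s0.
  by apply: lt_le_trans (weight_ge_sqr _ _ (ltW s00)); rewrite exprn_gt0.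
pose eta := e / weight E z0 s0.
have eta0 : 0 < eta by rewrite divr_gt0.
have -> : e = eta * weight E z0 s0 by rewrite divfK ?gt_eqF.
pose P z s := exists K, forall k, (K <= k)%N ->
  N (contour k f z s%:C%C) <= eta * weight E z s.
suff : P z0 s0 by [].
apply: square_induction => // {w0}.
  move=> z s sp [K1 H1] [K2 H2] [K3 H3] [K4 H4].
  exists (maxn (maxn K1 K2) (maxn K3 K4)).+1 => -[//|k].
  rewrite ltnS !geq_max => /andP[/andP[k1 k2] /andP[k3 k4]].
  rewrite contourS weight_quarters -real_complex_half.
  have tri (a b c d : C) : N (a + b + c + d) <= N a + N b + N c + N d.
    have := normcD (a + b + c) d; have := normcD (a + b) c.
    have := normcD a b; lra.
  apply: le_trans (tri _ _ _ _) _; rewrite 3!mulrDr.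
  apply: lerD; last exact: H4.
  apply: lerD; last exact: H3.
  by apply: lerD; [exact: H1|exact: H2].
move=> w zw; have [wE|wE] := boolP (w \in E).
  have [r r0 Hr] := contour_small_bounded eta0 (Hb _ wE).
  exists r => // z s sr zsw; exists 0%N => k _.
  apply: le_trans (Hr _ _ _ sr zsw) _.
  by rewrite ler_pM2l// (weight_ge_sqrt wE).
have [d Hwd] := Hd _ zw wE.
have [r r0 Hr] := contour_small_diff eta0 Hwd.
exists r => // z s sr zsw; exists 0%N => k _.
apply: le_trans (Hr _ _ _ sr zsw) _.
by rewrite ler_pM2l// weight_ge_sqr// ltW//; case/andP: sr.
Qed.

(** * Mean value bound and divided differences *)

Lemma quotient_cderiv (g : C -> C) (z p d c : C) : cderiv_at g z d -> z != p ->
  exists d', cderiv_at (fun w => (g w - c) / (w - p)) z d'.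
Proof.
move=> /cderiv_atP gd zp; apply: derivable_cderiv_at.
have zp0 : z - p != 0 by rewrite subr_eq0.
apply: (@derivableM _ _ (fun w => g w - c) (fun w => (w - p)^-1)).
  exact: (derivableB (ex_derive) (derivable_cst _ _ _)).
apply: (@derivableV _ _ (fun w => w - p)); first exact: zp0.
have H : derivable ((id : C -> C) - cst p) (z : C) (1 : C).
  by apply: derivableB; [exact: derivable_id|exact: derivable_cst].
exact: H.
Qed.

Lemma quotient_bounded_at (g : C -> C) (p d : C) : cderiv_at g p d ->
  loc_bounded (fun w => (g w - g p) / (w - p)) p.
Proof.
move=> /(_ 1 ltr01)[r r0 Hr]; exists (N d + 1), r; split=> // w wr.
rewrite normcM Normc.normcV; have [->|wp] := eqVneq w p.
  by rewrite !subrr Normc.normc0 mul0r addr_ge0// normc_ge0.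
rewrite ler_pdivrMr ?normc_gt0 ?subr_eq0//.
have := normcD (g w - g p - d * (w - p)) (d * (w - p)).
rewrite subrK normcM; have := Hr _ wr; lra.
Qed.

Lemma quotient_bounded_off (g : C -> C) (q p c : C) : loc_bounded g q -> q != p ->
  loc_bounded (fun w => (g w - c) / (w - p)) q.
Proof.
move=> [M [r [r0 HM]]] qp; have n0 : 0 < N (q - p).
  by rewrite normc_gt0 subr_eq0.
exists ((M + N c) / (N (q - p) / 2)), (Num.min r (N (q - p) / 2)); split.
  by rewrite lt_min r0 divr_gt0.
move=> w; rewrite lt_min => /andP[wr wq].
have h : N (q - p) / 2 <= N (w - p).
  have := normcD (q - w) (w - p); rewrite addrA subrK normc_distC in wq *.
  by rewrite [N (q - w)]normc_distC in wq *; lra.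
rewrite normcM Normc.normcV; apply: ler_pM.
- exact: normc_ge0.
- by rewrite invr_ge0 normc_ge0.
- by apply: le_trans (normcB_le _ _) _; rewrite lerD2r HM.
- by rewrite lef_pV2// posrE; lra.
Qed.

Lemma complex_inv (x y : R) : (x +i* y)%C^-1 =
  ((x / (x ^+ 2 + y ^+ 2)) +i* (- (y / (x ^+ 2 + y ^+ 2))))%C.
Proof. by []. Qed.

Lemma Im_inv_real (r x y : R) : Im (r%:C%C * (x +i* y)%C^-1) = - (r * y) / (x ^+ 2 + y ^+ 2).
Proof. by rewrite complex_inv /=; ring. Qed.

Lemma Im_inv_imag (r x y : R) :
  Im ('i%C * r%:C%C * (x +i* y)%C^-1) = r * x / (x ^+ 2 + y ^+ 2).
Proof. by rewrite complex_inv /=; ring. Qed.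

(** A discrete form of the value 2 pi i of the integral of dw / (w - c).  On each
    side of the square, v / (w - c) has imaginary part at least 1, and averaging
    preserves this. *)
Lemma contour_inv_ge (c : C) h k : 0 < h ->
  4 <= N (contour k (fun w => (w - c)^-1) (c - (h +i* h)%C) (2 * h)%:C%C).
Proof.
move=> h0; apply: le_trans (le_trans (ler_norm _) (normc_Im _)).
have ge1 x : `|x| <= h -> 1 <= 2 * h * h / (x ^+ 2 + h ^+ 2).
  rewrite ler_norml => xh; have := exprn_gt0 2 h0 => hh.
  have x2 := sqr_ge0 x.
  by rewrite ler_pdivlMr; [nra|lra].
have tb t : 0 <= t <= 1 -> `|2 * h * t - h| <= h.
  by move=> t01; rewrite ler_norml; nra.
have eqle (m a b : R) : a = b -> m <= b -> m <= a by move=> ->.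
rewrite /contour !raddfB raddfD.
set m1 := midsum _ _ _ _; set m2 := midsum _ _ _ _.
set m3 := midsum _ _ _ _; set m4 := midsum _ _ _ _.
suff : [/\ 1 <= Im m1, 1 <= Im m2, 1 <= Im (- m3) & 1 <= Im (- m4)].
  by rewrite !raddfN /=; case; lra.
rewrite -[- m3]mulN1r -[- m4]mulN1r -!midsumZ; split.
- apply: midsum_Im_ge => t /tb tt.
  have -> : c - (h +i* h)%C + t%:C%C * (2 * h)%:C%C - c =
      ((2 * h * t - h) +i* (- h))%C by case: (c) => a b; simpc; congr (_ +i* _)%C; ring.
  apply: eqle (Im_inv_real _ _ _) _; apply: le_trans (ge1 _ tt) _.
  by rewrite mulrN opprK sqrrN.
- apply: midsum_Im_ge => t /tb tt.
  have -> : c - (h +i* h)%C + (2 * h)%:C%C + t%:C%C * ('i%C * (2 * h)%:C%C) - c =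
      (h +i* (2 * h * t - h))%C by case: (c) => a b; simpc; congr (_ +i* _)%C; ring.
  by apply: eqle (Im_inv_imag _ _ _) _; apply: le_trans (ge1 _ tt) _; rewrite addrC.
- apply: midsum_Im_ge => t /tb tt.
  have -> : c - (h +i* h)%C + 'i%C * (2 * h)%:C%C + t%:C%C * (2 * h)%:C%C - c =
      ((2 * h * t - h) +i* h)%C by case: (c) => a b; simpc; congr (_ +i* _)%C; ring.
  rewrite mulrCA mulN1r raddfN; apply: le_trans (ge1 _ tt) _; rewrite lerNr.
  by apply: le_trans (eqle _ _ _ (esym (Im_inv_real _ _ _)) (lexx _)) _; rewrite mulNr.
- apply: midsum_Im_ge => t /tb tt.
  have -> : c - (h +i* h)%C + t%:C%C * ('i%C * (2 * h)%:C%C) - c =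
      ((- h) +i* (2 * h * t - h))%C by case: (c) => a b; simpc; congr (_ +i* _)%C; ring.
  rewrite mulrCA mulN1r raddfN; apply: le_trans (ge1 _ tt) _; rewrite lerNr.
  by apply: le_trans (eqle _ _ _ (esym (Im_inv_imag _ _ _)) (lexx _)) _; rewrite mulrN mulNr sqrrN addrC.
Qed.

Lemma on_edge_center c h w : 0 < h -> on_edge (c - (h +i* h)%C) (2 * h) w ->
  h <= N (w - c) <= 2 * h.
Proof.
move=> h0 /andP[]; rewrite /in_square !raddfB /= => hw edge.
have hr := normc_Re (w - c); have hi := normc_Im (w - c).
have hri := normc_ReIm (w - c); rewrite !raddfB /= in hr hi hri.
have r1 : `|Re w - Re c| <= h by rewrite ler_norml; lra.
have i1 : `|Im w - Im c| <= h by rewrite ler_norml; lra.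
apply/andP; split; last by lra.
have hN x : x = h \/ x = - h -> `|x| = h.
  by case=> ->; rewrite ?normrN gtr0_norm.
case/or4P: edge => /eqP e.
- by rewrite -[leLHS](hN (Re w - Re c))//; right; lra.
- by rewrite -[leLHS](hN (Re w - Re c))//; left; lra.
- by rewrite -[leLHS](hN (Im w - Im c))//; right; lra.
- by rewrite -[leLHS](hN (Im w - Im c))//; left; lra.
Qed.

Lemma in_square_center c h w : in_square (c - (h +i* h)%C) (2 * h) w ->
  N (w - c) <= 2 * h.
Proof.
have hri := normc_ReIm (w - c); move: hri; rewrite /in_square !raddfB /= => hri hw.
have r1 : `|Re w - Re c| <= h by rewrite ler_norml; lra.
have i1 : `|Im w - Im c| <= h by rewrite ler_norml; lra.
lra.
Qed.

(** Substitute for the maximum principle.  The difference quotient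
    (F w - F c) / (w - c) satisfies Goursat's theorem with c as one more
    exceptional point, so the sums of F w / (w - c) and of F c / (w - c) have the
    same limit; the first are at most 8 M, the second at least 4 |F c|. *)
Lemma mean_value_bound (F : C -> C) (E : seq C) (c : C) (h M : R) :
  0 < h -> c \notin E ->
  (forall w, N (w - c) <= 2 * h -> w \notin E -> exists d, cderiv_at F w d) ->
  (forall p, p \in E -> loc_bounded F p) ->
  (forall w, h <= N (w - c) <= 2 * h -> N (F w) <= M) ->
  N (F c) <= 2 * M.
Proof.
move=> h0 cE Fd Fb FM.
have [d Fc] : exists d, cderiv_at F c d.
  by apply: Fd => //; rewrite subrr Normc.normc0; lra.
pose G w := (F w - F c) / (w - c).
pose z0 := c - (h +i* h)%C.
have Gd w : in_square z0 (2 * h) w -> w \notin c :: E -> exists d, cderiv_at G w d.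
  move=> /in_square_center wh; rewrite inE negb_or => /andP[wc wE].
  have [d' Fw] := Fd w wh wE.
  exact: quotient_cderiv Fw wc.
have Gb p : p \in c :: E -> loc_bounded G p.
  rewrite inE => /predU1P[->|pE]; first exact: quotient_bounded_at Fc.
  apply: quotient_bounded_off; first exact: Fb.
  by apply: contraNneq cE => <-.
have h20 : 0 < 2 * h by lra.
apply/ler_addgt0Pr => e e0.
have e40 : 0 < 4 * e by lra.
have [K HK] := goursat h20 Gd Gb e40.
have := HK K (leqnn K) => {HK}.
set kap := contour K (fun w => (w - c)^-1) z0 (2 * h)%:C%C.
set cF := contour K (fun w => F w / (w - c)) z0 (2 * h)%:C%C.
have -> : contour K G z0 (2 * h)%:C%C = cF - F c * kap.
  rewrite /cF /kap -contourZ -contourB; congr contour.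
  by apply/funext => w; rewrite /G mulrBl.
have cFM : N cF <= 4 * (2 * h) * (M / h).
  apply: contour_le => // w /(on_edge_center h0)/andP[w1 w2].
  rewrite normcM Normc.normcV; apply: ler_pM.
  - exact: normc_ge0.
  - by rewrite invr_ge0 normc_ge0.
  - by apply: FM; rewrite w1.
  - by rewrite lef_pV2// posrE; lra.
have hM : 4 * (2 * h) * (M / h) = 8 * M by field; rewrite gt_eqF.
have k4 : 4 <= N kap := contour_inv_ge c K h0.
have := normcB_ge (F c * kap) cF; rewrite normcM [N (_ - cF)]normc_distC.
have := normc_ge0 (F c); nra.
Qed.

(** Newton's divided difference of f at the nodes z and l.  At z in l the value
    is the meaningless one produced by division by 0; these points are the
    exceptional points of [goursat], where only a bound matters. *)
Fixpoint divdiff (f : C -> C) (l : seq C) (z : C) : C :=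
  if l is p :: l' then (divdiff f l' z - divdiff f l' p) / (z - p) else f z.

Definition disc_holomorphic (f : C -> C) :=
  forall z, N z < 1 -> exists d, cderiv_at f z d.

Lemma divdiff_cderiv f l z : disc_holomorphic f -> N z < 1 -> z \notin l ->
  exists d, cderiv_at (divdiff f l) z d.
Proof.
move=> hf z1; elim: l => [_|p l IH]; first exact: hf.
rewrite inE negb_or => /andP[zp /IH[d fd]].
exact: quotient_cderiv fd zp.
Qed.

Lemma divdiff_loc_bounded f l p : disc_holomorphic f ->
  (forall q, q \in l -> N q < 1) -> uniq l -> p \in l ->
  loc_bounded (divdiff f l) p.
Proof.
move=> hf; elim: l => [//|q l IH] l1 /= /andP[ql ul].
rewrite inE => /predU1P[->|pl].
  have [d fd] := divdiff_cderiv hf (l1 _ (mem_head _ _)) ql.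
  exact: quotient_bounded_at fd.
apply: quotient_bounded_off.
  by apply: IH => // w wl; apply: l1; rewrite inE wl orbT.
by apply: contraNneq ql => <-.
Qed.

(** Cauchy estimate for divided differences.  When c is far from the nodes,
    dividing by c - p costs a factor 8 for each of two terms.  When c is close to
    0, [mean_value_bound] on a square of half-side 3/8 around c brings the
    estimate back to the far region, at the cost of a factor 2. *)
Lemma divdiff_bound f l c M : disc_holomorphic f ->
  (forall z, N z < 1 -> N (f z) <= M) ->
  (forall q, q \in l -> N q < 8^-1) -> uniq l -> c \notin l ->
  N c < 8^-1 \/ 4^-1 <= N c < 1 ->
  N (divdiff f l c) <= 32 ^+ size l * M.
Proof.
move=> hf fM; elim: l c => [|p l IH] c l8 /=.
  by move=> _ _ c1; rewrite expr0 mul1r; apply: fM; lra.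
move=> /andP[pl ul] cpl hc.
have p8 : N p < 8^-1 by apply: l8; rewrite mem_head.
have {}IH w : w \notin l -> N w < 8^-1 \/ 4^-1 <= N w < 1 ->
    N (divdiff f l w) <= 32 ^+ size l * M.
  by move=> *; apply: IH => // q ql; apply: l8; rewrite inE ql orbT.
set A := 32 ^+ size l * M in IH *.
(* w is at distance at least 1/8 from all nodes. *)
have far w : 4^-1 <= N w < 1 -> N (divdiff f (p :: l) w) <= 16 * A.
  move=> w41 /=; rewrite normcM Normc.normcV.
  have wl : w \notin l.
    by apply/negP => wl; have := l8 w; rewrite inE wl orbT => /(_ isT); lra.
  have h1 := IH w wl (or_intror w41).
  have h2 := IH p pl (or_introl p8).
  have h3 := normcB_le (divdiff f l w) (divdiff f l p).
  have h4 := normcB_ge w p.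
  rewrite ler_pdivrMr; last by lra.
  have A0 : 0 <= A := le_trans (normc_ge0 _) h1.
  nra.
have -> : 32 ^+ (size l).+1 * M = 2 * (16 * A) by rewrite exprS /A; ring.
case: hc => [c8|c4]; last first.
  apply: le_trans (far _ c4) _; have := le_trans (normc_ge0 _) (far _ c4); lra.
have l1 q : q \in p :: l -> N q < 1 by move=> /l8; lra.
(* Points at distance between 3/8 and 6/8 from c lie in the far region. *)
have h0 : 0 < 3 / 8 :> R by lra.
apply: (@mean_value_bound (divdiff f (p :: l)) (p :: l) c (3 / 8)) => //.
- move=> w wc wpl; apply: divdiff_cderiv => //.
  have := normcB_ge w c; lra.
- by move=> q ql; apply: divdiff_loc_bounded => //=; rewrite pl.
- move=> w wc; apply: far; have := normcB_ge w c; have := normcB_le w c; lra.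
Qed.

(** * The shift operator on bounded holomorphic functions *)

Lemma cvg_Re_Im (u : nat -> C) (a b : R) :
  (Re (u n) @[n --> \oo] --> a) -> (Im (u n) @[n --> \oo] --> b) ->
  u n @[n --> \oo] --> (a +i* b)%C.
Proof.
move=> ua ub; apply/cvg_complexP => e e0; have e20 : 0 < e / 2 by rewrite divr_gt0.
have [K1 _ H1] := (cvgrPdist_lt _ _).1 ua _ e20.
have [K2 _ H2] := (cvgrPdist_lt _ _).1 ub _ e20.
exists (maxn K1 K2) => n; rewrite geq_max => /andP[/H1 h1 /H2 h2].
apply: le_lt_trans (normc_ReIm _) _; rewrite !raddfB /=.
by rewrite distrC [X in _ + X]distrC [e]splitr ltrD.
Qed.

Lemma real_cauchy_cvg (u : nat -> R) :
  (forall e, 0 < e -> exists K, forall m n, (K <= m)%N -> (K <= n)%N ->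
     `|u m - u n| < e) -> exists l : R, u n @[n --> \oo] --> l.
Proof.
move=> H; suff : cvgn u by move=> /cvg_ex.
apply/cauchy_cvgP/cauchy_exP => e e0; have [K HK] := H e e0.
by exists (u K), K => // n Kn; rewrite /ball /= HK.
Qed.

Lemma complex_cauchy_cvg (u : nat -> C) :
  (forall e, 0 < e -> exists K, forall m n, (K <= m)%N -> (K <= n)%N ->
     N (u m - u n) < e) -> exists l : C, u n @[n --> \oo] --> l.
Proof.
move=> H.
have [a ua] : exists a : R, Re (u n) @[n --> \oo] --> a.
  apply: real_cauchy_cvg => e /H[K HK]; exists K => m n Km Kn.
  by rewrite -raddfB; apply: le_lt_trans (normc_Re _) (HK _ _ Km Kn).
have [b ub] : exists b : R, Im (u n) @[n --> \oo] --> b.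
  apply: real_cauchy_cvg => e /H[K HK]; exists K => m n Km Kn.
  by rewrite -raddfB; apply: le_lt_trans (normc_Im _) (HK _ _ Km Kn).
by exists (a +i* b)%C; exact: cvg_Re_Im.
Qed.

Lemma normc_lim_le (u : nat -> C) (l : C) (b : R) :
  u n @[n --> \oo] --> l -> (forall n, N (u n) <= b) -> N l <= b.
Proof.
move=> /cvg_complexP ul ub; apply/ler_addgt0Pr => e /ul[K /(_ K (leqnn K))].
by rewrite normc_distC; have := normcB_ge l (u K); have := ub K; lra.
Qed.

Lemma normc_sum (I : Type) (s : seq I) (P : pred I) (F : I -> C) :
  N (\sum_(i <- s | P i) F i) <= \sum_(i <- s | P i) N (F i).
Proof.
elim/big_rec2: _ => [|i x y _ xy]; first by rewrite Normc.normc0.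
by apply: le_trans (normcD _ _) _; rewrite lerD2l.
Qed.

(** Produces the derivative of a quotient at 0: the limit is first taken along
    the points 1 / (n + 1), then compared with all nearby points. *)
Lemma cauchy_at0 (Q : C -> C) :
  (forall e, 0 < e -> exists2 r, 0 < r & forall w w', 0 < N w < r ->
     0 < N w' < r -> N (Q w - Q w') <= e) ->
  exists L, forall e, 0 < e -> exists2 r, 0 < r & forall w, 0 < N w < r ->
     N (Q w - L) <= e.
Proof.
move=> H; pose t n : C := (n.+1%:R^-1 : R)%:C%C.
have tN n : N (t n) = n.+1%:R^-1.
  by rewrite normc_real ger0_norm// invr_ge0.
have tsmall r : 0 < r -> exists K, forall n, (K <= n)%N -> 0 < N (t n) < r.
  move=> r0; exists (Num.truncn r^-1) => n Kn; rewrite tN invr_gt0 ltr0n /=.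
  rewrite invf_plt ?posrE ?ltr0n//; apply: lt_le_trans (truncnS_gt _) _.
  by rewrite ler_nat.
have [L HL] : exists L : C, Q (t n) @[n --> \oo] --> L.
  apply: complex_cauchy_cvg => e e0; have [|r r0 Hr] := H (e / 2).
    by rewrite divr_gt0.
  have [K HK] := tsmall r r0; exists K => m n Km Kn.
  by apply: le_lt_trans (Hr _ _ (HK _ Km) (HK _ Kn)) _; lra.
exists L => e e0; have [|r r0 Hr] := H (e / 2); first by rewrite divr_gt0.
exists r => // w wr; have [K HK] := tsmall r r0.
have [|K' HK'] := (cvg_complexP _ _).1 HL (e / 2); first by rewrite divr_gt0.
have h1 := Hr w (t (maxn K K')) wr (HK _ (leq_maxl _ _)).
have h2 := HK' _ (leq_maxr K K').
have := normcD (Q w - Q (t (maxn K K'))) (Q (t (maxn K K')) - L).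
by rewrite addrA subrK; lra.
Qed.

Lemma cderiv_at_local (f g : C -> C) (z d : C) (r : R) : 0 < r ->
  (forall w, N (w - z) < r -> f w = g w) -> cderiv_at f z d -> cderiv_at g z d.
Proof.
move=> r0 fg fd e /fd[r' r'0 Hr]; exists (Num.min r r'); first by rewrite lt_min r0.
move=> w; rewrite lt_min => /andP[wr wr']; rewrite -!fg ?subrr ?Normc.normc0//.
exact: Hr.
Qed.

(** The quotient (f z - f 0) / z, completed at 0 by the derivative d, is again
    holomorphic and bounded. *)
Section DividedShift.
Variables (f : C -> C) (M : R).
Hypothesis hf : disc_holomorphic f.
Hypothesis fM : forall z, N z < 1 -> N (f z) <= M.
Variable d : C.
Hypothesis fd : cderiv_at f 0 d.

Let F z := if z == 0 then d else (f z - f 0) / z.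

Let N0 : N 0 = 0 := Normc.normc0 R.

Let FE z : z != 0 -> F z = divdiff f [:: 0] z.
Proof. by move=> z0; rewrite /F (negbTE z0) /= subr0. Qed.

Let Fcont e : 0 < e ->
  exists2 r, 0 < r & forall w, N w < r -> N (F w - F 0) <= e.
Proof.
move=> e0; have [r r0 Hr] := fd e0; exists r => // w wr.
have [->|w0] := eqVneq w 0; first by rewrite subrr N0 ltW.
have := Hr w; rewrite subr0 => /(_ wr).
rewrite /F eqxx (negbTE w0) => h.
have -> : (f w - f 0) / w - d = (f w - f 0 - d * w) / w by field.
by rewrite normcM Normc.normcV ler_pdivrMr ?normc_gt0.
Qed.

Let small_point (r : R) : 0 < r -> exists2 w : C, w != 0 & N w < r.
Proof.
move=> r0; exists (r / 2)%:C%C.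
  by rewrite -normc_gt0 normc_real gtr0_norm; lra.
by rewrite normc_real gtr0_norm; lra.
Qed.

Let M0 : 0 <= M.
Proof. by apply: le_trans (normc_ge0 (f 0)) (fM _); rewrite N0. Qed.

Let Fbound z : N z < 1 -> N (F z) <= 32 * M.
Proof.
have Fb0 w : w != 0 -> N w < 1 -> N (F w) <= 32 * M.
  move=> w0 w1; have [w8|w8] := ltP (N w) 8^-1.
    rewrite FE// -[32]expr1; apply: (@divdiff_bound f [:: 0]) => //.
    - by move=> q; rewrite inE => /eqP ->; rewrite N0; lra.
    - by rewrite inE.
    - by left.
  rewrite /F (negbTE w0) normcM Normc.normcV ler_pdivrMr ?normc_gt0//.
  have := normcB_le (f w) (f 0); have := fM w1; have := @fM 0.
  by rewrite N0; have := M0; nra.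
move=> z1; have [->|z0] := eqVneq z 0; last exact: Fb0.
apply/ler_addgt0Pr => e /Fcont[r r0 Hr].
have [|w w0] := small_point (r := Num.min r 1); first by rewrite lt_min r0 ltr01.
rewrite lt_min => /andP[/Hr h1 /(Fb0 _ w0) h2].
by have := normcB_ge (F 0) (F w); rewrite normc_distC; lra.
Qed.

Let B := 32 ^+ 3 * M.

(** The bound on the divided difference of f at 0, u, w, w', rewritten in terms
    of F, of which it is a second-order divided difference. *)
Let third_divdiff_le u w w' : u != 0 -> w != 0 -> w' != 0 -> u != w -> u != w' -> w != w' ->
  N u < 8^-1 -> N w < 8^-1 -> N w' < 8^-1 ->
  N (F u - F w - (F w' - F w) / (w' - w) * (u - w)) <= B * N (u - w') * N (u - w).
Proof.
move=> u0 w0 w'0 uw uw' ww' u8 w8 w'8.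
have : N (divdiff f [:: w'; w; 0] u) <= B.
  apply: divdiff_bound => //.
  - move=> q; rewrite !inE => /or3P[] /eqP -> //.
    by rewrite N0; lra.
  - by rewrite /= !inE negb_or w'0 w0 eq_sym ww'.
  - by rewrite !inE !negb_or u0 uw uw'.
  - by left.
have -> : divdiff f [:: w'; w; 0] u =
   ((F u - F w) / (u - w) - (F w' - F w) / (w' - w)) / (u - w').
  by rewrite !FE.
have uw1 : u - w != 0 by rewrite subr_eq0.
have uw2 : u - w' != 0 by rewrite subr_eq0.
set A := (F w' - F w) / (w' - w).
have -> : F u - F w - A * (u - w) =
    (((F u - F w) / (u - w) - A) / (u - w')) * (u - w') * (u - w) by field; rewrite uw1 uw2.
by move=> h; do 2!(rewrite normcM; apply: ler_wpM2r; first exact: normc_ge0).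
Qed.

(** The limit u -> 0 in [third_divdiff_le], where the continuity of F at 0 is
    used: the slope of F from 0 to w and the slope from w to w' differ by at most
    B |w'|. *)
Let slope w w' : w != 0 -> w' != 0 -> w != w' -> N w < 8^-1 -> N w' < 8^-1 ->
  N ((F w - F 0) / w - (F w' - F w) / (w' - w)) <= B * N w'.
Proof.
move=> w0 w'0 ww' w8 w'8; set A := (F w' - F w) / (w' - w).
have B0 : 0 <= B by rewrite mulr_ge0// ?M0// exprn_ge0.
have nw : 0 < N w by rewrite normc_gt0.
have nw' : 0 < N w' by rewrite normc_gt0.
have NA := normc_ge0 A.
suff h : N (F w - F 0 - A * w) <= B * N w * N w'.
  have -> : (F w - F 0) / w - A = (F w - F 0 - A * w) / w by field.
  by rewrite normcM Normc.normcV ler_pdivrMr// (mulrAC B).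
apply/ler_addgt0Pr => e e0; have e20 : 0 < e / 2 by lra.
have [r r0 Hr] := Fcont e20.
pose t := e / 2 / (B + N A + 1).
have t0 : 0 < t by rewrite divr_gt0//; lra.
have te : t * (B + N A + 1) = e / 2 by rewrite divfK// gt_eqF//; lra.
have [|u u0] := small_point (r := Num.min (Num.min r t) (Num.min (N w) (N w'))).
  by rewrite !lt_min r0 t0 nw nw'.
rewrite !lt_min => /andP[/andP[ur ut] /andP[uw uw']].
have uw1 : u != w by apply/eqP => uw1; move: uw; rewrite uw1 ltxx.
have uw2 : u != w' by apply/eqP => uw2; move: uw'; rewrite uw2 ltxx.
have u8 : N u < 8^-1 by lra.
have h1 := third_divdiff_le u0 w0 w'0 uw1 uw2 ww' u8 w8 w'8.
rewrite -/A in h1.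
have h2 := Hr u ur.
have h3 : B * N (u - w') * N (u - w) <= B * N w * N w' + B * N u.
  have a1 := normcB_le u w'; have a2 := normcB_le u w.
  have n0 := normc_ge0 (u - w); have n1 := normc_ge0 (u - w').
  have nu := normc_ge0 u.
  have : N (u - w') * N (u - w) <= N w * N w' + N u.
    apply: (@le_trans _ _ ((N u + N w') * (N u + N w))); first exact: ler_pM.
    nra.
  by move=> h; have := ler_wpM2l B0 h; rewrite mulrDr !mulrA.
have -> : F w - F 0 - A * w =
    (F u - F 0) - (F u - F w - A * (u - w)) - A * u by ring.
have := normcB_le (F u - F 0 - (F u - F w - A * (u - w))) (A * u).
have := normcB_le (F u - F 0) (F u - F w - A * (u - w)).
rewrite normcM.
have : (B + N A) * N u <= (B + N A + 1) * t.
  have := normc_ge0 u; nra.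
lra.
Qed.

(** Exchanging the roles of w and w' in [slope] compares the two slopes at 0, so
    the difference quotient of F at 0 satisfies the Cauchy criterion. *)
Let Fcderiv0 : exists L, cderiv_at F 0 L.
Proof.
have B0 : 0 <= B by rewrite mulr_ge0// ?M0// exprn_ge0.
have slope2 w w' : w != 0 -> w' != 0 -> N w < 8^-1 -> N w' < 8^-1 ->
    N ((F w - F 0) / w - (F w' - F 0) / w') <= B * (N w + N w').
  move=> w0 w'0 w8 w'8; have [->|ww'] := eqVneq w w'.
    by rewrite subrr N0 mulr_ge0// addr_ge0 ?normc_ge0.
  have h1 := slope w0 w'0 ww' w8 w'8.
  have := slope w'0 w0; rewrite eq_sym => /(_ ww' w'8 w8).
  have -> : (F w - F w') / (w - w') = (F w' - F w) / (w' - w).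
    by rewrite -[F w - F w']opprB -[w - w']opprB invrN mulrNN.
  rewrite normc_distC; set A := _ / (w' - w) in h1 *.
  have := normcD ((F w - F 0) / w - A) (A - (F w' - F 0) / w').
  by rewrite addrA subrK; lra.
have [|L HL] := @cauchy_at0 (fun w => (F w - F 0) / w).
  move=> e e0; have t0 : 0 < e / (2 * B + 1) by rewrite divr_gt0//; lra.
  have te : e / (2 * B + 1) * (2 * B + 1) = e by rewrite divfK// gt_eqF//; lra.
  exists (Num.min 8^-1 (e / (2 * B + 1))).
    by rewrite lt_min t0 andbT invr_gt0.
  move=> w w'; rewrite !lt_min !normc_gt0.
  move=> /and3P[w0 w8 wt] /and3P[w'0 w'8 w't].
  by apply: le_trans (slope2 _ _ w0 w'0 w8 w'8) _; nra.
exists L => e /HL[r r0 Hr]; exists r => // w; rewrite subr0 => wr.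
have [->|w0] := eqVneq w 0; first by rewrite mulr0 subr0 subrr N0 mulr0.
have := Hr w; rewrite wr normc_gt0 w0 => /(_ isT) h.
have -> : F w - F 0 - L * w = ((F w - F 0) / w - L) * w by field.
by rewrite normcM ler_wpM2r// normc_ge0.
Qed.

Let Fcderiv : disc_holomorphic F.
Proof.
move=> z z1; have [->|z0] := eqVneq z 0; first exact: Fcderiv0.
have [d' fz] := hf z1.
have [e He] := quotient_cderiv (f 0) fz z0.
exists e; apply: (@cderiv_at_local _ _ z _ (N z) _ _ He); first by rewrite normc_gt0.
move=> w; have [->|w0 _] := eqVneq w 0; first by rewrite sub0r normc_opp ltxx.
by rewrite /F (negbTE w0) subr0.
Qed.

Lemma divided_shift_of_deriv :
  exists F, [/\ disc_holomorphic F,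
    forall z, N z < 1 -> N (F z) <= 32 * M &
    forall z, f z = f 0 + z * F z].
Proof.
exists F; split; [exact: Fcderiv|exact: Fbound|move=> z].
rewrite /F; have [->|z0] := eqVneq z 0; first by rewrite mul0r addr0.
by rewrite mulrCA divff// mulr1 addrC subrK.
Qed.

End DividedShift.

(** Schwarz-type lemma: removing the zero of f z - f 0 keeps holomorphy and
    multiplies the bound by at most 32. *)
Lemma divided_shift (f : C -> C) (M : R) : disc_holomorphic f ->
  (forall z, N z < 1 -> N (f z) <= M) ->
  exists F, [/\ disc_holomorphic F,
    forall z, N z < 1 -> N (F z) <= 32 * M &
    forall z, f z = f 0 + z * F z].
Proof.
move=> hf fM; have [|d fd] := hf 0; first by rewrite Normc.normc0.
exact: divided_shift_of_deriv hf fM _ fd.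
Qed.

(** * Termwise differentiation of power series *)

Definition psum (a : nat -> C) (z : C) (n : nat) : C := \sum_(k < n) a k * z ^+ k.

Definition dcoef (a : nat -> C) (k : nat) : C := k.+1%:R * a k.+1.

(** Second-order Taylor remainder of the monomial of degree k, multiplied by r^2
    so as to avoid the exponent k - 2. *)
Lemma power_term_bound k (w z : C) (r : R) : N z <= r -> N w <= r ->
  N (w ^+ k - z ^+ k - k%:R * z ^+ k.-1 * (w - z)) * r ^+ 2 <=
  k%:R ^+ 2 * r ^+ k * N (w - z) ^+ 2.
Proof.
move=> zr wr; have r0 : 0 <= r by apply: le_trans zr; exact: normc_ge0.
elim: k => [|k IH].
  by rewrite !expr0 subrr !mul0r subr0 Normc.normc0 mul0r expr0n /= !mul0r.
have -> : w ^+ k.+1 - z ^+ k.+1 - k.+1%:R * z ^+ k * (w - z) =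
    w * (w ^+ k - z ^+ k - k%:R * z ^+ k.-1 * (w - z)) +
    k%:R * z ^+ k.-1 * (w - z) ^+ 2.
  case: k {IH} => [|k] /=; first by rewrite !expr0 !expr1; ring.
  by rewrite ![_ ^+ k.+1]exprS ![_ ^+ k.+2]exprS ![_ ^+ k.+1]exprS -!natr1; ring.
set T := w ^+ k - z ^+ k - _ in IH *; set D := N (w - z) ^+ 2 in IH *.
have D0 : 0 <= D by rewrite exprn_ge0 ?normc_ge0.
have zk : k%:R * N z ^+ k.-1 * r <= k%:R * r ^+ k.
  case: k {IH T} => [|k]; first by rewrite !mul0r.
  rewrite /= exprSr -mulrA ler_wpM2l// ler_wpM2r//.
  by rewrite lerXn2r ?nnegrE ?normc_ge0.
apply: (@le_trans _ _ (r * (N T * r ^+ 2) + k%:R * r ^+ k * r * D)).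
  apply: (@le_trans _ _ ((N w * N T + k%:R * N z ^+ k.-1 * D) * r ^+ 2)).
    rewrite ler_wpM2r ?exprn_ge0//; apply: le_trans (normcD _ _) _.
    by rewrite (normcM w) (normcM _ ((w - z) ^+ 2)) (normcM k%:R) !normcX normc_nat.
  rewrite mulrDl; apply: lerD.
    by rewrite -mulrA ler_wpM2r// mulr_ge0 ?normc_ge0// exprn_ge0.
  have -> : k%:R * N z ^+ k.-1 * D * r ^+ 2 = (k%:R * N z ^+ k.-1 * r) * (r * D) by ring.
  by rewrite -[leRHS]mulrA ler_wpM2r// mulr_ge0.
have := ler_wpM2l r0 IH.
have p : 0 <= r * r ^+ k * D by apply: mulr_ge0 => //; apply: mulr_ge0 => //; apply: exprn_ge0.
rewrite (exprS r k) -natr1; set K := k%:R; have K0 : 0 <= K by rewrite /K.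
by have := mulr_ge0 K0 p; nra.
Qed.

Lemma psum_dcoef a z n : psum (dcoef a) z n = \sum_(k < n.+1) a k * (k%:R * z ^+ k.-1).
Proof.
rewrite big_ord_recl /= mul0r mulr0 add0r; apply: eq_bigr => k _ /=.
by rewrite /dcoef mulrA [_ * a _]mulrC.
Qed.

Lemma geometric_sum_le (q : R) n : 0 <= q < 1 -> \sum_(k < n) q ^+ k <= (1 - q)^-1.
Proof.
move=> /andP[q0 q1]; have q10 : 0 < 1 - q by lra.
rewrite -[leRHS]mul1r ler_pdivlMr//.
suff -> : (\sum_(k < n) q ^+ k) * (1 - q) = 1 - q ^+ n.
  by have := exprn_ge0 n q0; lra.
by have := subrX1 q n; rewrite mulrC; lra.
Qed.

(** The remainders of the monomials add up to a convergent geometric series times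
    (w - z)^2.  The hypothesis on k^2 a_k is adapted to the coefficients 1 / k^2,
    for which it gives differentiability on the whole open disc. *)
Lemma power_series_cderiv (a : nat -> C) (B rho r0 : R) (f g : C -> C) :
  0 <= rho -> rho * r0 <= 1 ->
  (forall k, N (a k) * k%:R ^+ 2 <= B * rho ^+ k) ->
  (forall z, N z < r0 -> psum a z n @[n --> \oo] --> f z) ->
  (forall z, N z < r0 -> psum (dcoef a) z n @[n --> \oo] --> g z) ->
  forall z, N z < r0 -> cderiv_at f z (g z).
Proof.
move=> rho0 rr0 aB fa ga z zr0.
pose r := (N z + r0) / 2.
have nz := normc_ge0 z.
have zr : N z < r by rewrite /r; lra.
have rlt : r < r0 by rewrite /r; lra.
have rpos : 0 < r by lra.
pose q := rho * r.
have q0 : 0 <= q by rewrite mulr_ge0// ltW.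
have q1 : q < 1.
  have [rhoE|rho1] := eqVneq rho 0; first by rewrite /q rhoE mul0r.
  by rewrite /q; apply: lt_le_trans rr0; rewrite ltr_pM2l// lt_def rho1.
have B0 : 0 <= B.
  by have := aB 0%N; rewrite expr0 mulr1; apply: le_trans; rewrite expr0n /= mulr0.
pose K := B * (1 - q)^-1 / r ^+ 2.
have K0 : 0 <= K.
  apply: divr_ge0; last by apply: exprn_ge0; exact: ltW.
  by apply: mulr_ge0; rewrite // invr_ge0; lra.
have quad w : N w <= r -> N (f w - f z - g z * (w - z)) <= K * N (w - z) ^+ 2.
  move=> wr.
  have lim : psum a w n.+1 - psum a z n.+1 - psum (dcoef a) z n * (w - z)
      @[n --> \oo] --> (f w - f z - g z * (w - z) : C).
    apply: cvgB; last by apply: cvgMl; exact: ga.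
    by apply: cvgB; rewrite (cvg_shiftS (psum a _)); apply: fa => //; apply: le_lt_trans rlt.
  apply: normc_lim_le lim _.
  move=> n; rewrite psum_dcoef /psum mulr_suml -!sumrB.
  rewrite /K mulrAC ler_pdivlMr ?exprn_gt0//.
  apply: (@le_trans _ _ (\sum_(k < n.+1) B * N (w - z) ^+ 2 * q ^+ k)); last first.
    rewrite -mulr_sumr [leRHS]mulrAC ler_wpM2l ?mulr_ge0 ?exprn_ge0 ?normc_ge0//.
    by apply: geometric_sum_le; rewrite q0.
  apply: (@le_trans _ _ ((\sum_(k < n.+1) N (a k) *
      N (w ^+ k - z ^+ k - k%:R * z ^+ k.-1 * (w - z))) * r ^+ 2)).
    apply: ler_wpM2r; first by apply: exprn_ge0; exact: ltW.
    apply: le_trans (normc_sum _ _ _) _.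
    apply: ler_sum => k _; rewrite -normcM le_eqVlt; apply/orP; left.
    by apply/eqP; congr N; ring.
  rewrite mulr_suml; apply: ler_sum => k _; rewrite -mulrA.
  apply: (@le_trans _ _ (N (a k) * (k%:R ^+ 2 * r ^+ k * N (w - z) ^+ 2))).
    by rewrite ler_wpM2l ?normc_ge0// power_term_bound// ltW.
  have -> : N (a k) * (k%:R ^+ 2 * r ^+ k * N (w - z) ^+ 2) =
      N (a k) * k%:R ^+ 2 * (r ^+ k * N (w - z) ^+ 2) by ring.
  have -> : B * N (w - z) ^+ 2 * q ^+ k = B * rho ^+ k * (r ^+ k * N (w - z) ^+ 2).
    by rewrite /q exprMn_comm; [ring|exact: mulrC].
  apply: ler_wpM2r; last exact: aB.
  by apply: mulr_ge0; apply: exprn_ge0; [exact: ltW|exact: normc_ge0].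
move=> e e0; exists (Num.min (r - N z) (e / (K + 1))).
  by rewrite lt_min divr_gt0//; lra.
move=> w; rewrite lt_min => /andP[wz we].
apply: le_trans (quad w _) _.
  have := normcD (w - z) z; rewrite subrK; lra.
rewrite expr2 mulrA ler_wpM2r ?normc_ge0//.
have : e / (K + 1) * (K + 1) = e by rewrite divfK// gt_eqF//; lra.
have := normc_ge0 (w - z); nra.
Qed.

(** * Taylor expansion at 0 *)

Lemma psumS (a : nat -> C) z n : psum a z n.+1 = psum a z n + a n * z ^+ n.
Proof. by rewrite /psum big_ord_recr. Qed.

Lemma abs_summable_cvg (u : nat -> C) (B : R) :
  (forall n, \sum_(k < n) N (u k) <= B) ->
  exists l : C, \sum_(k < n) u k @[n --> \oo] --> l.
Proof.
move=> uB; pose S n := \sum_(k < n) N (u k).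
have Snd : nondecreasing_seq S.
  by apply/nondecreasing_seqP => n; rewrite /S big_ord_recr /= lerDl normc_ge0.
have Scvg : cvgn S.
  by apply: nondecreasing_is_cvgn => //; exists B => _ [n _ <-]; exact: uB.
have step m p : N (\sum_(k < m + p) u k - \sum_(k < m) u k) <= S (m + p)%N - S m.
  rewrite /S [\sum_(k < m + p) u k]big_split_ord.
  rewrite [\sum_(k < m + p) N (u k)]big_split_ord /=.
  by rewrite 2!(addrAC _ _ (- _)) !subrr !add0r; exact: normc_sum.
have dist m n : N (\sum_(k < m) u k - \sum_(k < n) u k) <= `|S m - S n|.
  have [mn|/ltnW nm] := leqP m n.
    rewrite normc_distC distrC -(subnKC mn).
    exact: le_trans (step _ _) (ler_norm _).
  by rewrite -(subnKC nm); exact: le_trans (step _ _) (ler_norm _).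
apply: complex_cauchy_cvg => e e0; have e20 : 0 < e / 2 by rewrite divr_gt0.
have [K _ HK] := (cvgrPdist_lt _ _).1 Scvg _ e20.
exists K => m n Km Kn; apply: le_lt_trans (dist m n) _.
have h1 : `|limn S - S m| < e / 2 := HK m Km.
have h2 : `|limn S - S n| < e / 2 := HK n Kn.
have := ler_distD (limn S) (S m) (S n); rewrite (distrC (S m) (limn S)); lra.
Qed.

Lemma power_series_cvg (a : nat -> C) (B q : R) (z : C) : 0 <= q < 1 ->
  (forall k, N (a k * z ^+ k) <= B * q ^+ k) ->
  exists l : C, psum a z n @[n --> \oo] --> l.
Proof.
move=> q01 aB; have B0 : 0 <= B.
  by have := aB 0%N; rewrite !expr0 !mulr1; apply: le_trans; exact: normc_ge0.
apply: (@abs_summable_cvg (fun k => a k * z ^+ k) (B * (1 - q)^-1)) => n.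
apply: (@le_trans _ _ (\sum_(k < n) B * q ^+ k)); first exact: ler_sum.
by rewrite -mulr_sumr ler_wpM2l// geometric_sum_le.
Qed.

(** Only the germ at 0 matters for the iterated derivatives at 0, hence the
    unspecified radius r. *)
Definition has_power_series (f : C -> C) (a : nat -> C) :=
  (exists B rho : R, 0 < rho /\ forall k, N (a k) <= B * rho ^+ k) /\
  (exists2 r : R, 0 < r &
     forall z, N z < r -> psum a z n @[n --> \oo] --> f z).

(** The factor k.+1 in [dcoef], and the k^2 required by [power_series_cderiv], are
    absorbed into the geometric rate since k.+1 <= 2^k; the radius shrinks
    accordingly. *)
Lemma has_power_series_derive1 f a :
  has_power_series f a -> has_power_series (derive1 f) (dcoef a).
Proof.
move=> [[B [rho [rho0 aB]]] [r r0 fa]].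
have B0 : 0 <= B.
  by have := aB 0%N; rewrite expr0 mulr1; apply: le_trans; exact: normc_ge0.
have k2 k : (k.+1)%:R <= 2 ^+ k :> R.
  by rewrite -natrX ler_nat; exact: (ltn_expl k (isT : (1 < 2)%N)).
have dB k : N (dcoef a k) <= B * rho * (2 * rho) ^+ k.
  rewrite /dcoef normcM normc_nat.
  have -> : B * rho * (2 * rho) ^+ k = 2 ^+ k * (B * rho ^+ k.+1).
    by rewrite exprMn_comm; [rewrite exprS; ring|exact: mulrC].
  apply: ler_pM; rewrite ?normc_ge0//.
have aB2 k : N (a k) * k%:R ^+ 2 <= B * (4 * rho) ^+ k.
  have -> : B * (4 * rho) ^+ k = (B * rho ^+ k) * (2 ^+ k) ^+ 2.
    rewrite exprMn_comm; last exact: mulrC.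
    by rewrite exprAC (_ : 2 ^+ 2 = 4) ; [ring|ring].
  apply: ler_pM; rewrite ?normc_ge0 ?exprn_ge0//.
  rewrite lerXn2r ?nnegrE ?exprn_ge0//; apply: le_trans (k2 k).
  by rewrite ler_nat.
(* On this disc the terms of the derived series are O(4^-k). *)
pose r1 := Num.min r (8 * rho)^-1.
have r1r : r1 <= r by rewrite ge_min lexx.
have r1p : r1 <= (8 * rho)^-1 by rewrite ge_min lexx orbT.
have r10 : 0 < r1 by rewrite lt_min r0 invr_gt0 mulr_gt0.
have rr1 : rho * r1 <= 8^-1.
  have := ler_wpM2l (ltW rho0) r1p.
  by have -> : rho * (8 * rho)^-1 = 8^-1 by field; rewrite gt_eqF.
have ex z : exists l : C, N z < r1 -> psum (dcoef a) z n @[n --> \oo] --> l.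
  have [zr|zr] := ltP (N z) r1; last by exists 0.
  have [||l Hl] := @power_series_cvg (dcoef a) (B * rho) (2 * rho * N z) z.
  - have := normc_ge0 z; nra.
  - move=> k; rewrite normcM normcX [X in _ <= _ * X]exprMn_comm; last exact: mulrC.
    by rewrite mulrA; apply: ler_wpM2r => //; rewrite exprn_ge0 ?normc_ge0.
  by exists l.
have [g Hg] := choice ex.
have rho40 : 0 <= 4 * rho by lra.
have rr41 : 4 * rho * r1 <= 1 by lra.
have fa1 z : N z < r1 -> psum a z n @[n --> \oo] --> f z.
  by move=> zr; apply: fa; apply: lt_le_trans r1r.
have fg := power_series_cderiv rho40 rr41 aB2 fa1 Hg.
split.
  by exists (B * rho), (2 * rho); split; rewrite ?mulr_gt0.
exists r1; first exact: r10.
by move=> z zr; rewrite (cderiv_at_derive1 (fg z zr)); exact: (Hg z zr).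
Qed.

Lemma has_power_series0 f a : has_power_series f a -> f 0 = a 0%N.
Proof.
move=> [_ [r r0 /(_ 0)]]; rewrite Normc.normc0 => /(_ r0) H.
have p0 n : psum a 0 n.+1 = a 0%N.
  rewrite /psum big_ord_recl big1 ?addr0 ?expr0 ?mulr1// => k _.
  by rewrite expr0n mulr0.
apply/eqP; rewrite -subr_eq0 -normc_eq0 eq_le normc_ge0 andbT.
apply/ler_addgt0Pr => e /((cvg_complexP _ _).1 H)[K /(_ K.+1 (leqnSn K))].
by rewrite p0 normc_distC add0r => /ltW.
Qed.

Lemma has_power_series_derive1n f a m : has_power_series f a ->
  derive1n m f 0 = m`!%:R * a m.
Proof.
elim: m f a => [|m IH] f a fa; first by rewrite mul1r; exact: has_power_series0.
have -> : derive1n m.+1 f = derive1n m (derive1 f) by rewrite /derive1n iterSr.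
rewrite (IH _ _ (has_power_series_derive1 fa)) /dcoef.
by rewrite mulrA -natrM factS mulnC.
Qed.

Lemma taylor_coef_derive1n f a n k : has_power_series f a ->
  taylor_coef (derive1n n f) k = (k + n)`!%:R / k`!%:R * a (k + n)%N.
Proof.
move=> fa; have e : derive1n k (derive1n n f) = derive1n (k + n) f.
  by rewrite /derive1n iterD.
by rewrite /taylor_coef e (has_power_series_derive1n _ fa) mulrAC.
Qed.

Lemma has_power_seriesD f g a b (c : C) :
  has_power_series f a -> has_power_series g b ->
  has_power_series (fun z => f z + c * g z) (fun k => a k + c * b k).
Proof.
move=> [[B [rho [rho0 aB]]] [r r0 fa]] [[B' [rho' [rho'0 bB]]] [r' r'0 gb]].
have B0 : 0 <= B.
  by have := aB 0%N; rewrite expr0 mulr1; apply: le_trans; exact: normc_ge0.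
have B'0 : 0 <= B'.
  by have := bB 0%N; rewrite expr0 mulr1; apply: le_trans; exact: normc_ge0.
split.
  exists (B + N c * B'), (rho + rho'); split; first by rewrite addr_gt0.
  move=> k; apply: le_trans (normcD _ _) _; rewrite mulrDl normcM -mulrA.
  apply: lerD; [apply: le_trans (aB k) _|apply: ler_wpM2l; first exact: normc_ge0].
    by apply: ler_wpM2l => //; rewrite lerXn2r ?nnegrE; lra.
  apply: le_trans (bB k) _.
  by apply: ler_wpM2l => //; rewrite lerXn2r ?nnegrE; lra.
exists (Num.min r r'); first by rewrite lt_min r0.
move=> z; rewrite lt_min => /andP[zr zr'].
have -> : psum (fun k => a k + c * b k) z = (fun n => psum a z n + c * psum b z n).
  apply/funext => n; rewrite /psum mulr_sumr -big_split /=.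
  by apply: eq_bigr => k _; ring.
apply: (@cvgD _ (C : normedModType C)); first exact: fa.
by apply: (@cvgMr C); exact: gb.
Qed.

(** The coefficients are the values at 0 of the iterates of [divided_shift].  The
    remainder after n terms is z^n times the n-th iterate, hence at most
    (32 |z|)^n M. *)
Lemma taylor_expansion (f : C -> C) (M : R) : disc_holomorphic f ->
  (forall z, N z < 1 -> N (f z) <= M) ->
  exists a, has_power_series f a /\ forall k, N (a k) <= 32 ^+ k * M.
Proof.
move=> hf fM.
have ex (q : (C -> C) * R) : exists F, disc_holomorphic q.1 ->
    (forall z, N z < 1 -> N (q.1 z) <= q.2) ->
    [/\ disc_holomorphic F, forall z, N z < 1 -> N (F z) <= 32 * q.2 &
        forall z, q.1 z = q.1 0 + z * F z].
  have [h|h] := pselect (disc_holomorphic q.1 /\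
      forall z, N z < 1 -> N (q.1 z) <= q.2).
    by have [F HF] := divided_shift h.1 h.2; exists F.
  by exists 0 => h1 h2; case: h.
have [nx Hnx] := choice ex.
pose F := fix F n := if n is m.+1 then nx (F m, 32 ^+ m * M) else f.
have FP n : disc_holomorphic (F n) /\ forall z, N z < 1 -> N (F n z) <= 32 ^+ n * M.
  elim: n => [|n [IH1 IH2]]; first by split=> // z z1; rewrite expr0 mul1r; exact: fM.
  by have [h1 h2 _] := Hnx (F n, 32 ^+ n * M) IH1 IH2; split; rewrite // exprS -mulrA.
have FS n z : F n z = F n 0 + z * F n.+1 z.
  by have [h1 h2] := FP n; have [_ _] := Hnx (F n, 32 ^+ n * M) h1 h2; apply.
pose a n := F n 0.
have N0 : N 0 < 1 by rewrite Normc.normc0.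
have aM k : N (a k) <= 32 ^+ k * M by exact: (FP k).2.
have fE n z : f z = psum a z n + z ^+ n * F n z.
  elim: n => [|n ->]; first by rewrite /psum big_ord0 add0r mul1r.
  by rewrite psumS (FS n z) exprSr /a; ring.
exists a; split=> //; split.
  by exists M, 32; split => // k; rewrite mulrC.
exists 64^-1 => [|z z64]; first by rewrite invr_gt0.
have z1 : N z < 1 by lra.
have M0 : 0 <= M by apply: le_trans (normc_ge0 (f 0)) (fM _ _).
apply/cvg_complexP => e e0.
have [K HK] := half_pow_lt M e0.
exists K => n Kn; rewrite normc_distC (fE n) addrAC subrr add0r normcM normcX.
apply: le_lt_trans HK; apply: (@le_trans _ _ (N z ^+ n * (32 ^+ n * M))).
  by apply: ler_wpM2l; [rewrite exprn_ge0 ?normc_ge0|exact: (FP n).2].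
rewrite mulrA -exprMn_comm; last exact: mulrC.
rewrite mulrC ler_wpM2l// -exprVn.
apply: (@le_trans _ _ (2^-1 ^+ n)).
  by rewrite lerXn2r ?nnegrE; have := normc_ge0 z; lra.
by apply: ler_wiXn2l => //; lra.
Qed.

(** * The coefficient functionals on the disc algebra *)

Lemma disc_algebra_holomorphic (f : disc_algebra R) : disc_holomorphic f.
Proof.
have [_ hf _] := disc_algebraP _ (disc_algebra_mem f).
move=> z z1; apply: derivable_cderiv_at; apply: hf.
by rewrite /unit_disc /= -[1]/(1%:C%C) ltc_normc.
Qed.

Lemma closed_unit_discE (z : C) : closed_unit_disc z <-> N z <= 1.
Proof. by rewrite /closed_unit_disc /= -[1]/(1%:C%C) Defs.normcE lecR. Qed.

Lemma disc_algebra_taylor (f : disc_algebra R) :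
  exists a, has_power_series f a /\ forall k, N (a k) <= 32 ^+ k * sup_norm f.
Proof.
apply: taylor_expansion; first exact: disc_algebra_holomorphic.
by move=> z z1; apply: le_sup_norm; apply/closed_unit_discE/ltW.
Qed.

Definition higher_coef (n : nat) (f : disc_algebra R) (k : nat) : C :=
  taylor_coef (derive1n n f) k.

Definition cauchy_const (n k : nat) : R := (k + n)`!%:R / k`!%:R * 32 ^+ (k + n).

Lemma cauchy_const_ge0 n k : 0 <= cauchy_const n k.
Proof. by rewrite mulr_ge0 ?exprn_ge0 ?divr_ge0. Qed.

Lemma higher_coef_le n f k :
  N (higher_coef n f k) <= cauchy_const n k * sup_norm f.
Proof.
have [a [fa aB]] := disc_algebra_taylor f.
rewrite /higher_coef (taylor_coef_derive1n _ _ fa) !normcM Normc.normcV !normc_nat.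
by rewrite /cauchy_const -[leRHS]mulrA ler_wpM2l ?divr_ge0.
Qed.

Lemma higher_coefD n (f g : disc_algebra R) (c : C) k :
  higher_coef n (f + c *: g) k = higher_coef n f k + c * higher_coef n g k.
Proof.
have [a [fa _]] := disc_algebra_taylor f.
have [b [gb _]] := disc_algebra_taylor g.
rewrite /higher_coef (taylor_coef_derive1n _ _ fa) (taylor_coef_derive1n _ _ gb).
have fgab : has_power_series (f + c *: g : disc_algebra R) (fun k => a k + c * b k).
  exact: has_power_seriesD fa gb.
by rewrite (taylor_coef_derive1n _ _ fgab); ring.
Qed.

(** The series of moduli in [ell1] takes its values in the complex field, where
    the order is partial; monotone convergence is replaced by the convergence of
    a complex series with bounded absolute sums. *)
Lemma ell1P (u : nat -> C) :
  ell1 u <-> exists B, forall n, \sum_(k < n) N (u k) <= B.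
Proof.
have sE n : [normed series u] n = (\sum_(k < n) N (u k))%:C%C.
  by rewrite /= /series /= big_mkord rmorph_sum.
split=> [/cvg_ex[l /cvg_complexP Hl]|[B HB]].
  have [K HK] := Hl 1 ltr01; exists (N l + 1 + \sum_(k < K) N (u k)) => n.
  have S0 m : 0 <= \sum_(k < m) N (u k) by apply: sumr_ge0 => *; exact: normc_ge0.
  have [Kn|/ltnW nK] := leqP K n.
    have h : N ((\sum_(k < n) N (u k))%:C%C - l) < 1 by rewrite -sE; exact: HK.
    have := normcB_ge (\sum_(k < n) N (u k))%:C%C l.
    by rewrite normc_real ger0_norm//; have := S0 K; lra.
  have -> : \sum_(k < K) N (u k) = \sum_(k < n) N (u k) +
      \sum_(n <= k < K) N (u k).
    by rewrite -!(big_mkord xpredT (fun k => N (u k))) -big_cat_nat.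
  have : 0 <= \sum_(n <= k < K) N (u k) by apply: sumr_ge0 => *; exact: normc_ge0.
  by have := normc_ge0 l; lra.
have [n|l Hl] := @abs_summable_cvg (fun k => (N (u k))%:C%C) B.
  apply: le_trans (HB n); apply: ler_sum => k _.
  by rewrite normc_real ger0_norm ?normc_ge0.
apply/cvg_ex; exists l; apply/cvg_complexP => e e0.
have [K HK] := (cvg_complexP _ _).1 Hl e e0.
exists K => n Kn; rewrite -[_ < e]/(N ([normed series u] n - l) < e).
by rewrite sE rmorph_sum; exact: HK.
Qed.

(** The coefficients of the function z |-> sum_k z^k / k^2; the coefficient at
    k = 0 is 0 because the inverse of 0 is 0. *)
Definition invsq (k : nat) : C := (k%:R ^+ 2)^-1.

(** Telescoping of 1 / k^2 <= 1 / (k - 1) - 1 / k. *)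
Lemma invsq_tail z n m : N z <= 1 ->
  N (psum invsq z (n.+2 + m) - psum invsq z n.+2) <=
  n.+1%:R^-1 - (n.+1 + m)%:R^-1.
Proof.
move=> z1; elim: m => [|m IH].
  by rewrite !addn0 !subrr Normc.normc0.
rewrite (addnS n.+2 m) psumS addrAC.
apply: le_trans (normcD _ _) _.
have t : N (invsq (n.+2 + m) * z ^+ (n.+2 + m)) <= ((n.+2 + m)%:R ^+ 2)^-1.
  rewrite normcM normcX /invsq Normc.normcV normcX normc_nat ler_piMr//.
  by rewrite exprn_ile1 ?normc_ge0.
have s : ((n.+2 + m)%:R ^+ 2)^-1 <= (n.+1 + m)%:R^-1 - (n.+1 + m.+1)%:R^-1 :> R.
  have -> : (n.+2 + m)%:R = (n.+1 + m)%:R + 1 :> R by rewrite addSn -natr1.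
  have -> : (n.+1 + m.+1)%:R = (n.+1 + m)%:R + 1 :> R by rewrite addnS -natr1.
  have x0 : 0 < (n.+1 + m)%:R :> R by rewrite ltr0n.
  set x := (n.+1 + m)%:R in x0 *.
  have -> : x^-1 - (x + 1)^-1 = (x * (x + 1))^-1 by field; rewrite !gt_eqF//; lra.
  by rewrite lef_pV2 ?posrE; nra.
by apply: le_trans (lerD IH (le_trans t s)) _; rewrite addrA subrK.
Qed.

Lemma invsq_cvg z : exists l : C, N z <= 1 -> psum invsq z n @[n --> \oo] --> l.
Proof.
have [z1|z1] := leP (N z) 1; last by exists 0.
suff [l Hl] : exists l : C, psum invsq z n @[n --> \oo] --> l by exists l.
apply: complex_cauchy_cvg => e e0.
(* The index is chosen so that the tail from n.+2 on is less than e / 2. *)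
pose n := Num.truncn (2 / e).
have ne : n.+1%:R^-1 < e / 2.
  by rewrite -[e / 2]invf_div ltf_pV2 ?posrE ?divr_gt0 ?truncnS_gt.
have tail m : (n.+2 <= m)%N -> N (psum invsq z m - psum invsq z n.+2) < e / 2.
  move=> /subnKC <-; apply: le_lt_trans (invsq_tail _ _ z1) _.
  by apply: le_lt_trans ne; rewrite gerBl invr_ge0.
exists n.+2 => i j /tail hi /tail hj.
have := normcB_le (psum invsq z i - psum invsq z n.+2) (psum invsq z j - psum invsq z n.+2).
by rewrite opprB addrA subrK; lra.
Qed.

(** The k-th term is Lipschitz with constant 1 / k <= 1 on the closed disc. *)
Lemma psum_invsq_lip z w n : N z <= 1 -> N w <= 1 ->
  N (psum invsq w n - psum invsq z n) <= n%:R * N (w - z).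
Proof.
move=> z1 w1.
have pw k : N (w ^+ k - z ^+ k) <= k%:R * N (w - z).
  elim: k => [|k IH]; first by rewrite subrr Normc.normc0 mul0r.
  have -> : w ^+ k.+1 - z ^+ k.+1 = w * (w ^+ k - z ^+ k) + z ^+ k * (w - z).
    by rewrite !exprS; ring.
  have h1 := normcD (w * (w ^+ k - z ^+ k)) (z ^+ k * (w - z)).
  rewrite !normcM normcX in h1.
  have h2 : N w * N (w ^+ k - z ^+ k) <= k%:R * N (w - z).
    by apply: le_trans IH; rewrite ler_piMl ?normc_ge0.
  have h3 : N z ^+ k * N (w - z) <= N (w - z).
    by rewrite ler_piMl ?normc_ge0// exprn_ile1 ?normc_ge0.
  by rewrite -natr1 mulrDl mul1r; lra.
elim: n => [|n IH]; first by rewrite /psum !big_ord0 subrr Normc.normc0 mul0r.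
have -> : psum invsq w n.+1 - psum invsq z n.+1 =
    psum invsq w n - psum invsq z n + invsq n * (w ^+ n - z ^+ n).
  by rewrite !psumS; ring.
have h1 := normcD (psum invsq w n - psum invsq z n) (invsq n * (w ^+ n - z ^+ n)).
have h2 : N (invsq n * (w ^+ n - z ^+ n)) <= N (w - z).
  rewrite normcM /invsq Normc.normcV normcX normc_nat.
  case: n {IH h1} => [|n]; first by rewrite expr0n /= invr0 mul0r normc_ge0.
  apply: (@le_trans _ _ ((n.+1%:R ^+ 2)^-1 * (n.+1%:R * N (w - z)))).
    by rewrite ler_wpM2l// invr_ge0 exprn_ge0.
  rewrite mulrA ler_piMl ?normc_ge0// expr2 invfM -mulrA mulVf ?pnatr_eq0// mulr1.
  by rewrite invf_le1 ?ltr0n// ler1n.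
by rewrite -natr1 mulrDl mul1r; lra.
Qed.

(** Continuity on the closed disc comes from the uniform tail estimate together
    with the Lipschitz bound on partial sums; differentiability inside comes from
    [power_series_cderiv] with rho = r0 = 1. *)
Lemma disc_algebra_invsq : exists h : disc_algebra R,
  has_power_series h invsq.
Proof.
have [L HL] := choice invsq_cvg.
pose h z := if N z <= 1 then L z else 0.
have hE z : N z <= 1 -> psum invsq z n @[n --> \oo] --> h z.
  by move=> z1; rewrite /h z1; exact: HL.
have htail z n : N z <= 1 -> N (h z - psum invsq z n.+2) <= n.+1%:R^-1.
  move=> z1; have lim : psum invsq z (m + n.+2) - psum invsq z n.+2 @[m --> \oo]
      --> (h z - psum invsq z n.+2 : C).
    apply: cvgB; last exact: cvg_cst.
    by rewrite (cvg_shiftn n.+2 (psum invsq z)); exact: hE.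
  apply: normc_lim_le lim _ => m; rewrite addnC.
  by apply: le_trans (invsq_tail _ _ z1) _; rewrite gerBl invr_ge0.
have hcont z e : N z <= 1 -> 0 < e -> exists2 r, 0 < r & forall w,
    N w <= 1 -> N (w - z) < r -> N (h w - h z) < e.
  move=> z1 e0; pose n := Num.truncn (4 / e).
  have ne : n.+1%:R^-1 < e / 4.
    by rewrite -[e / 4]invf_div ltf_pV2 ?posrE ?divr_gt0 ?truncnS_gt.
  exists (e / 4 / n.+2%:R) => [|v v1]; first by rewrite !divr_gt0.
  rewrite ltr_pdivlMr ?ltr0n// => vz.
  have h1 := le_lt_trans (htail z n z1) ne.
  have h2 := le_lt_trans (htail v n v1) ne.
  have h3 : N (psum invsq v n.+2 - psum invsq z n.+2) < e / 4.
    by apply: le_lt_trans (psum_invsq_lip _ z1 v1) _; rewrite mulrC.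
  have -> : h v - h z = (h v - psum invsq v n.+2) +
    (psum invsq v n.+2 - psum invsq z n.+2) - (h z - psum invsq z n.+2) by ring.
  have := normcB_le (h v - psum invsq v n.+2 + (psum invsq v n.+2 - psum invsq z n.+2))
     (h z - psum invsq z n.+2).
  have := normcD (h v - psum invsq v n.+2) (psum invsq v n.+2 - psum invsq z n.+2).
  lra.
have hhol z : N z < 1 -> exists d, cderiv_at h z d.
  have ex w : exists l : C, N w < 1 -> psum (dcoef invsq) w n @[n --> \oo] --> l.
    have [w1|w1] := ltP (N w) 1; last by exists 0.
    have [||l Hl] := @power_series_cvg (dcoef invsq) 1 (N w) w; last by exists l.
      by rewrite normc_ge0.
    move=> k; rewrite mul1r normcM normcX ler_piMl ?exprn_ge0 ?normc_ge0//.
    rewrite /dcoef /invsq normcM Normc.normcV normcX normc_nat expr2 invfM.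
    by rewrite mulrA mulfV ?pnatr_eq0// mul1r invf_le1 ?ltr0n// ler1n.
  have [g Hg] := choice ex.
  have bB k : N (invsq k) * k%:R ^+ 2 <= 1 * 1 ^+ k :> R.
    rewrite expr1n mul1r /invsq Normc.normcV normcX normc_nat.
    by case: k => [|k]; rewrite ?expr0n /= ?mulr0// mulVf// expf_neq0// pnatr_eq0.
  have one1 : 1 * 1 <= 1 :> R by rewrite mulr1.
  have hE' w : N w < 1 -> psum invsq w n @[n --> \oo] --> h w.
    by move=> /ltW w1; exact: hE.
  move=> z1; exists (g z).
  exact: (power_series_cderiv ler01 one1 bB hE' Hg z1).
have hmem : h \in disc_algebra_pred.
  apply/disc_algebraP; split.
  - apply/subspace_continuousP => z /closed_unit_discE z1.
    apply/cvgrPdist_lt => _ /gt0_complex[e e0 ->].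
    have [r r0 Hr] := hcont z e z1 e0.
    apply/nbhs_ballP; exists r%:C%C; first by rewrite /= ltcR.
    move=> w; rewrite -ball_normE /= ltc_normc normc_distC => wr /closed_unit_discE w1.
    by rewrite ltc_normc normc_distC Hr.
  - move=> z; rewrite /unit_disc /= -[1]/(1%:C%C) ltc_normc => /hhol[d Hd].
    by have [] := (cderiv_atP _ _ _).1 Hd.
  - by move=> z /closed_unit_discE z1; rewrite /h (negbTE (introN idP z1)).
exists (DiscAlgebra hmem); split.
  exists 1, 1; split=> // k; rewrite expr1n mulr1 /invsq Normc.normcV normcX normc_nat.
  case: k => [|k]; first by rewrite expr0n /= invr0.
  by rewrite invf_le1 ?exprn_gt0 ?ltr0n// expr_ge1// ler1n.
exists 1; first exact: ltr01.
by move=> z /ltW z1; exact: hE.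
Qed.

(** Two of the n factors of (k + n)!/k! almost cancel (k + n)^2, and the others
    are at least 1. *)
Lemma invsq_not_ell1 n : (1 < n)%N ->
  ~ ell1 (fun k => (k + n)`!%:R / k`!%:R * invsq (k + n)).
Proof.
move=> n1 /ell1P[B HB].
have half k : 2^-1 <= N ((k + n)`!%:R / k`!%:R * invsq (k + n)).
  case: n n1 {HB} => [|[|n]] // _.
  rewrite !normcM !Normc.normcV normcX !normc_nat.
  have fk : k`!%:R <= (k + n)`!%:R :> R by rewrite ler_nat leq_fact// leq_addr.
  have k0 : 0 < k`!%:R :> R by rewrite ltr0n fact_gt0.
  rewrite !addnS !factS !natrM -[(k + n).+2%:R]natr1 -[(k + n).+1%:R]natr1; set x := (k + n)%:R.
  have x0 : 0 <= x :> R by rewrite /x.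
  have e : ((x + 1 + 1) * ((x + 1) * (k + n)`!%:R)) / k`!%:R / (x + 1 + 1) ^+ 2 =
      ((x + 1) / (x + 1 + 1)) * ((k + n)`!%:R / k`!%:R).
    by field; rewrite !gt_eqF//; lra.
  rewrite e; have a1 : 1 <= (k + n)`!%:R / k`!%:R :> R by rewrite ler_pdivlMr ?mul1r.
  have a2 : 2^-1 <= (x + 1) / (x + 1 + 1) by rewrite ler_pdivlMr; lra.
  apply: le_trans a2 _; apply: ler_peMr => //.
  by apply: divr_ge0; lra.
pose m := (Num.truncn (2 * B)).+1.
have := HB m; apply/negP; rewrite -ltNge.
apply: (@lt_le_trans _ _ (\sum_(k < m) 2^-1)); last exact: ler_sum.
rewrite sumr_const card_ord -[_ *+ m]mulr_natl ltr_pdivlMr// mulrC.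
exact: truncnS_gt.
Qed.

(** * The Gdelta property and density *)

Lemma higher_coef_sum_le n (f g : disc_algebra R) m :
  \sum_(k < m) N (higher_coef n f k) <= \sum_(k < m) N (higher_coef n g k) +
    (\sum_(k < m) (cauchy_const n k : R)) * sup_norm (f - g).
Proof.
rewrite mulr_suml -big_split /=; apply: ler_sum => k _.
have -> : higher_coef n f k = higher_coef n g k + higher_coef n (f - g) k.
  by have := higher_coefD n g (f - g) 1 k; rewrite scale1r mul1r addrC subrK.
by apply: le_trans (normcD _ _) _; rewrite lerD2l higher_coef_le.
Qed.

Lemma nonsummable_derivativeP n (f : disc_algebra R) :
  nonsummable_derivative n f <->
  forall j : nat, exists m, j%:R < \sum_(k < m) N (higher_coef n f k).
Proof.
rewrite /nonsummable_derivative /=; split=> [nf j|H /ell1P[B HB]].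
  apply: contrapT => /forallNP H; apply: nf; apply/ell1P; exists j%:R => m.
  by rewrite leNgt; apply/negP; exact: H.
have [m] := H (Num.truncn B).+1; apply/negP; rewrite -leNgt.
by apply: le_trans (HB m) (ltW (truncnS_gt _)).
Qed.

Lemma nbhs_sup_norm (f : disc_algebra R) (A : set (disc_algebra R)) :
  nbhs f A <-> exists2 e : R, 0 < e & forall g, sup_norm (f - g) < e -> A g.
Proof.
split=> [/nbhs_ballP[_ /gt0_complex[e e0 ->] H]|[e e0 H]].
  exists e => // g fg; apply: H; rewrite -ball_normE /=.
  by rewrite disc_algebra_normE ltcR.
apply/nbhs_ballP; exists e%:C%C; first by rewrite /= ltcR.
by move=> g; rewrite -ball_normE /= disc_algebra_normE ltcR; exact: H.
Qed.

(** A partial sum is Lipschitz in f for the sup norm, being a finite sum of moduli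
    of bounded linear functionals. *)
Lemma open_large_partial_sum n (j : nat) :
  open [set f : disc_algebra R |
    exists m, j%:R < \sum_(k < m) N (higher_coef n f k)].
Proof.
rewrite openE => f [m fm]; apply/nbhs_sup_norm.
set S := \sum_(k < m) _ in fm; pose K := \sum_(k < m) (cauchy_const n k : R).
have K0 : 0 <= K by apply: sumr_ge0 => k _; exact: cauchy_const_ge0.
exists ((S - j%:R) / (K + 1)) => [|g]; first by rewrite divr_gt0//; lra.
rewrite ltr_pdivlMr; last by lra.
move=> fg; exists m; have := higher_coef_sum_le n f g m.
have := sup_norm_ge0 (f - g); rewrite -/K -/S; nra.
Qed.

Lemma Gdelta_nonsummable n : Gdelta (@nonsummable_derivative R n).
Proof.
exists (fun j : nat => [set f : disc_algebra R |
    exists m, j%:R < \sum_(k < m) N (higher_coef n f k)]).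
  by move=> j; exact: open_large_partial_sum.
apply/seteqP; split=> f.
  by move=> /nonsummable_derivativeP H j _; exact: H.
by move=> H; apply/nonsummable_derivativeP => j; exact: H.
Qed.

Lemma dense_nonsummable n : (1 < n)%N -> dense (@nonsummable_derivative R n).
Proof.
move=> n1 O [f Of] oO; have [nf|] := pselect (nonsummable_derivative n f).
  by exists f.
move=> /contrapT/ell1P[B1 HB1].
have [h hb] : exists h : disc_algebra R, has_power_series h invsq.
  exact: disc_algebra_invsq.
have hcoef k : higher_coef n h k = (k + n)`!%:R / k`!%:R * invsq (k + n).
  exact: taylor_coef_derive1n.
have [e e0 He] : exists2 e : R, 0 < e & forall g, sup_norm (f - g) < e -> O g.
  by apply/nbhs_sup_norm; exact: open_nbhs_nbhs.
have h0 := sup_norm_ge0 h.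
pose c : R := e / (sup_norm h + 1).
have c0 : 0 < c by rewrite divr_gt0//; lra.
exists (f + c%:C%C *: h); split.
  apply: He; rewrite opprD addrA subrr sub0r -scaleNr.
  suff -> : sup_norm (- c%:C%C *: h) = c * sup_norm h.
    have : c * (sup_norm h + 1) = e by rewrite divfK// gt_eqF//; lra.
    nra.
  have := sup_normZ (- c%:C%C) h; rewrite normrN Defs.normcE normc_real gtr0_norm//.
  by rewrite -rmorphM => -[].
move=> /ell1P[B2 HB2]; apply: (invsq_not_ell1 n1); apply/ell1P.
exists ((B1 + B2) / c) => m; rewrite ler_pdivlMr// mulr_suml.
apply: le_trans (lerD (HB1 m) (HB2 m)); rewrite -big_split /=.
apply: ler_sum => k _.
have := higher_coefD n f h c%:C%C k; rewrite hcoef {1 2}/higher_coef => ->.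
set u := taylor_coef _ _; set v := _ * invsq _.
have := normcB_le (u + c%:C%C * v) u.
by rewrite addrAC subrr add0r normcM normc_real gtr0_norm//; lra.
Qed.

End NonsummableDerivatives.

Theorem theorem3p6 (R : realType) (n : nat) (hn : (1 < n)%N) :
  Gdelta (@nonsummable_derivative R n) /\ dense (@nonsummable_derivative R n).
Proof. by split; [exact: Gdelta_nonsummable|exact: dense_nonsummable]. Qed.
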